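(* There exist universal constants $C_0,D_1,D_2,\gamma>0$ such that the following holds. Let $0<q<1$, let $\Theta$ be a positive integer, let $I=[a,b]$, and let $\nu$ be a probability measure on $I$ with density $\nu(x)$. Let $N,m,s$ be positive integers and $K\ge 1$ with $$m\ge C_0 K^2 s\log^3(s)\log(N+1).$$ Let $\{\psi_0,\psi_1,\dots,\psi_N\}$ be polynomials on $I$ that are orthonormal with respect to $\nu$, whose degrees are strictly increasing and do not exceed $N$, and that are uniformly bounded: $\|\psi_k\|_\infty\le K$ for $k=0,\dots,N$. Let $x_1,\dots,x_m$ be drawn independently from $I$, each with probability density $\nu(x)$, and let $A\in\mathbb{R}^{m\times(N+1)}$ have entries $A_{j,k}=\psi_k(x_j)$, $j=1,\dots,m$, $k=0,\dots,N$. Let $f$ be a function on $[a,b]$ having a bounded derivative $f'$ with $|f'(x)|\le M_1$ on $[a,b]$, and put $\mathbf{y}=(f(x_1),\dots,f(x_m))^T$. Then, with probability at least $1-(N+1)^{-\gamma\log^3(s)}$, the following holds: if $\mathbf{c}^\#=(c_0^\#,\dots,c_N^\#)^T$ is a solution of $$\min_{\mathbf{z}\in\mathbb{R}^{N+1}}\|\mathbf{z}\|_1\quad\text{subject to}\quad \|A\mathbf{z}-\mathbf{y}\|_2\le\Theta\sqrt{m}\,E_N,$$ and $p^\#(x)=\sum_{k=0}^N c_k^\#\psi_k(x)$, then $$\|f-p^\#\|_\infty\le K D_1\|p_{opt}\|_{A_q}s^{1-\frac1q}+6(b-a)M_1\left(K D_2\Theta+1\right)\frac{\sqrt{s}}{N}.$$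 Here $p_{opt}$ is the best uniform approximation polynomial of $f$ in $\Pi_N(I)=\mathrm{span}\{\psi_0,\dots,\psi_N\}$ and $E_N$ is the best uniform approximation error of $f$ in $\Pi_N(I)$.
   Context: $\|g\|_\infty=\max_{x\in[a,b]}|g(x)|$ for continuous $g$ on $[a,b]$. $\Pi_N(I)$ is the space of polynomials on $I$ of degree at most $N$. $E_N=E_N(f)=\inf_{p\in\Pi_N(I)}\|f-p\|_\infty$, and $p_{opt}\in\Pi_N(I)$ satisfies $\|f-p_{opt}\|_\infty=E_N$. Orthonormal with respect to $\nu$ means $\int_I\psi_j(x)\psi_k(x)\nu(x)\,dx=\delta_{jk}$. For a vector $\mathbf{z}$, $\|\mathbf{z}\|_p=(\sum_j|z_j|^p)^{1/p}$ for $0<p<\infty$. For $g=\sum_{k=0}^N c_k\psi_k$, $\|g\|_{A_q}:=\|\mathbf{c}\|_q$, $q>0$. ''Universal constants'' means independent of all the other data. *)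

(* Defs.v *)
From HB Require Import structures.
From mathcomp Require Import all_boot all_order all_algebra.
From mathcomp Require Import all_classical all_reals all_analysis.

Set Implicit Arguments.
Unset Strict Implicit.
Unset Printing Implicit Defensive.

Import Order.TTheory GRing.Theory Num.Theory.
Import numFieldNormedType.Exports.

Local Open Scope classical_set_scope.
Local Open Scope ring_scope.

Section Approximation.
Context {R : realType}.
Implicit Types (a b : R) (f g : R -> R) (p : {poly R}) (N : nat).

(* For g continuous on [a, b] with a <= b this supremum is a maximum. *)
Definition sup_norm a b g : R := sup [set `|g x| | x in `[a, b]].

(* [size p] is deg p + 1, so [size p <= N.+1] says deg p <= N. *)
Definition polys_le N : set {poly R} := [set p | (size p <= N.+1)%N].

Definition best_error a b N f : R :=
  inf [set sup_norm a b (fun x => f x - p.[x]) | p in polys_le N].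

Definition is_best_approx a b N f p : Prop :=
  polys_le N p /\ sup_norm a b (fun x => f x - p.[x]) = best_error a b N f.

(* One-sided at a and at b; values of f outside [a, b] are irrelevant. *)
Definition has_derivative_on a b f (df : R -> R) : Prop :=
  forall x, x \in `[a, b] ->
    (f y - f x) / (y - x) @[y --> within `[a, b] x^'] --> df x.

Definition lp_norm (p : R) n (z : 'cV[R]_n) : R :=
  (\sum_(j < n) `|z j 0| `^ p) `^ p^-1.

(* The coefficients are unique when psi is linearly independent; the default
   0 is taken when g is not in the span of psi. *)
Definition coefs n (psi : 'I_n -> {poly R}) (g : {poly R}) : 'cV[R]_n :=
  xget 0 [set c : 'cV[R]_n | g = \sum_(k < n) c k 0 *: psi k].

Definition A_norm n (psi : 'I_n -> {poly R}) (q : R) (g : {poly R}) : R :=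
  lp_norm q (coefs psi g).

Definition is_prob_density a b (nu : R -> R) : Prop :=
  [/\ measurable_fun `[a, b] nu,
      forall x, x \in `[a, b] -> 0 <= nu x &
      (\int[@lebesgue_measure R]_(x in `[a, b]) (nu x)%:E = 1)%E].

Definition orthonormal_wrt a b (nu : R -> R) n (psi : 'I_n -> {poly R}) : Prop :=
  forall j k : 'I_n,
    (\int[@lebesgue_measure R]_(x in `[a, b])
       ((psi j).[x] * (psi k).[x] * nu x)%:E = ((j == k)%:R : R)%:E)%E.

Definition is_l1_minimizer m n (A : 'M[R]_(m, n)) (y : 'cV[R]_m) (eta : R)
    (c : 'cV[R]_n) : Prop :=
  lp_norm 2 (A *m c - y) <= eta /\
  forall z : 'cV[R]_n, lp_norm 2 (A *m z - y) <= eta ->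
    lp_norm 1 c <= lp_norm 1 z.

End Approximation.

Section Sampling.
Context {R : realType} {d : measure_display} {T : measurableType d}
  (P : probability T R).

Definition has_density_on a b (nu : R -> R) (X : {RV P >-> R}) : Prop :=
  forall B : set R, measurable B ->
    distribution P X B =
    (\int[@lebesgue_measure R]_(x in B `&` `[a, b]) (nu x)%:E)%E.

Definition mutually_independent m (X : 'I_m -> {RV P >-> R}) : Prop :=
  forall (J : {set 'I_m}) (B : 'I_m -> set R),
    (forall j, j \in J -> measurable (B j)) ->
    (P (\bigcap_(j in [set` J]) (X j @^-1` B j)) =
     \prod_(j in J) P (X j @^-1` B j))%E.

Definition iid_sample a b nu m (X : 'I_m -> {RV P >-> R}) : Prop :=
  [/\ forall j w, a <= X j w <= b,
      forall j, has_density_on a b nu (X j) &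
      mutually_independent X].

(* Q is not required to be measurable: it must contain a measurable event of
   probability at least r. *)
Definition with_prob_ge (r : R) (Q : T -> Prop) : Prop :=
  exists E : set T,
    [/\ measurable E, (r%:E <= P E)%E & forall w, E w -> Q w].

End Sampling.

(* Main.v *)
(* No restricted isometry is needed, only a restricted eigenvalue bound: with the
   stated probability every h with |h|_1 <= 4 2^L |h|_2 (where s <= 4^L <= 4 s)
   has |h|_2^2 <= 768 * (empirical mean of g_h^2), g_h = sum_k h_k psi_k. If h is
   the error of the l1 minimizer, then either this bound applies, or |h|_1 is
   controlled by the best s-term error through the cone condition.

   Since E g_h^2 = |h|_2^2, the bound is a uniform lower deviation. Cut g_h^2 at
   the levels t_i = K 2^i. At level i, Maurey's sampling replaces g_h by an
   average of about L 4^(L-i) signed psi_k, within t_i / 2 at all but an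
   exponentially small fraction of the points, for the law nu and for the sample
   alike. The family of such averages is finite, so a one-sided Chernoff bound
   with error about 1/L + 4^(i-L) and a union bound suffice: the entropy
   L 4^(L-i) ln N decreases with i as fast as the exponent m / t_i^2 does. The
   errors are summable over i <= L, and the last levels give the failure
   probability N^(-L^3).

   The approximation error is estimated by Jackson's theorem, with a discretized
   Jackson kernel whose triangular coefficients make the mean of
   (cos th - cos t)^2 at most of order 1/N^2. *)

(* The obstacle is size: [|g_h|] may reach [K 2^(L+2)]. One concentration bound for [g_h^2] over one
   net would pay the largest range and the largest entropy together, about [K^2 4^L] times
   [L 4^L ln N], which is quadratic in s. Levels pair each range with its own net.

   Threshold indicators are unstable under approximation, so the thresholds are relaxed on the way:
   [g_h] above [2 t] under nu, its average above [3/2 t] under nu and then on the sample, [g_h]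
   above [t] on the sample. Each passage absorbs an error [t / 2] at the price of a constant factor.

   One average must be close to [g_h] for both laws at once. Its mean square error is governed by a
   mixture of the [psi_k^2]; these have mean 1 under nu, and a separate event keeps their empirical
   means below 3. Bounding them by [K^2] would put a further [K^2] into the entropy of level 0. *)
Require Import Defs.
From HB Require Import structures.
From mathcomp Require Import all_boot all_order all_algebra.
From mathcomp Require Import all_classical all_reals all_analysis.
From mathcomp Require Import measurable_realfun zify ring lra.

Set Implicit Arguments.
Unset Strict Implicit.
Unset Printing Implicit Defensive.

Import Order.TTheory GRing.Theory Num.Theory.
Import numFieldNormedType.Exports.

Local Open Scope classical_set_scope.
Local Open Scope ring_scope.

(** * Expectations of products of independent variables *)

Section Weighted.
Local Open Scope ereal_scope.
Context d (T : measurableType d) (R : realType) (mu : {measure set T -> \bar R}).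
Variables (D : set T) (mD : measurable D) (G : T -> R) (X : T -> R).
Variable mu2 : {measure set R -> \bar R}.
Hypotheses (mG : measurable_fun D G) (G0 : forall x, D x -> (0 <= G x)%R).
Hypothesis mX : measurable_fun setT X.
Hypothesis GX : forall B, measurable B ->
  \int[mu]_(x in D) (G x * \1_B (X x))%:E = mu2 B.

Import HBNNSimple.

(** Both sides are monotone limits along simple approximations of [F], and for indicators the claim
    is [GX]. It serves twice: for independence, with [G] the other factors of a product, and for the
    sampling law, with [G] a density and [X] the identity. *)
Lemma integral_weighted_pushforward (F : R -> R) :
  measurable_fun setT F -> (forall x, 0 <= F x)%R ->
  \int[mu]_(x in D) (G x * F (X x))%:E = \int[mu2]_x (F x)%:E.
Proof.
move=> mF F0.
have mEF : measurable_fun setT (EFin \o F) by exact/measurable_EFinP.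
have mXD Y : measurable_fun setT Y -> measurable_fun D (fun x => Y (X x) : R).
  by move=> mY; apply: measurable_funTS; apply: measurableT_comp.
pose h := nnsfun_approx measurableT mEF.
have hF x : EFin \o h^~ x @ \oo --> (F x)%:E.
  by apply: cvg_nnsfun_approx => // y _; rewrite lee_fin.
have -> : \int[mu2]_x (F x)%:E = limn (fun n => \int[mu2]_x (h n x)%:E).
  rewrite -monotone_convergence//.
  - by apply: eq_integral => x _; apply/esym/cvg_lim => //; exact: hF.
  - by move=> n; exact/measurable_EFinP.
  - by move=> n x _; rewrite lee_fin.
  - by move=> x _ a b ab; rewrite lee_fin; exact/lefP/nd_nnsfun_approx.
have -> : \int[mu]_(x in D) (G x * F (X x))%:E =
    limn (fun n => \int[mu]_(x in D) (G x * h n (X x))%:E).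
  rewrite -monotone_convergence//.
  - apply: eq_integral => x /[!inE] Dx; apply/esym/cvg_lim => //.
    under eq_fun do rewrite EFinM.
    by rewrite EFinM; apply: cvgeZl => //; exact: hF.
  - move=> n; apply/measurable_EFinP; apply: measurable_funM => //.
    exact: mXD.
  - by move=> n x Dx; rewrite lee_fin mulr_ge0// G0.
  - move=> x Dx a b ab; rewrite lee_fin ler_wpM2l ?G0//.
    exact/lefP/nd_nnsfun_approx.
congr (limn _); apply/funext => n.
have mind (r : R) : measurable (h n @^-1` [set r]) by [].
transitivity (\int[mu2]_x
   (\sum_(y \in range (h n)) (y * \1_(h n @^-1` [set y]) x)%:E)); last first.
  by apply: eq_integral => t tE; rewrite /= fimfunE -fsumEFin.
rewrite ge0_integral_fsum//; last 2 first.
- move=> y; apply/measurable_EFinP; apply: measurable_funM => //.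
- by move=> m y Ey; exact: nnfun_muleindic_ge0.
transitivity (\int[mu]_(x in D) (\sum_(y \in range (h n))
    (y * (G x * \1_(h n @^-1` [set y]) (X x)))%:E)).
  apply: eq_integral => x _; rewrite fsumEFin// fimfunE; congr EFin.
  rewrite mulrC !fsbig_finite//= mulr_suml; apply: eq_bigr => y _.
  by rewrite mulrAC mulrA.
rewrite ge0_integral_fsum//; last 2 first.
- move=> y; apply/measurable_EFinP; apply: measurable_funM => //.
  by apply: measurable_funM => //; apply: mXD.
- move=> y x Dx; rewrite mulrCA EFinM mule_ge0 ?lee_fin ?G0//.
  exact: nnfun_muleindic_ge0.
apply: eq_fsbigr => r; rewrite inE => -[t _ <-].
under eq_integral do rewrite EFinM.
under [in RHS]eq_integral do rewrite EFinM.
rewrite !ge0_integralZl//.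
all: try by rewrite lee_fin.
- by rewrite GX// integral_indic// setIT.
- exact/measurable_EFinP.
- by apply/measurable_EFinP; apply: measurable_funM => //; exact: mXD.
- by move=> x Dx; rewrite lee_fin mulr_ge0// G0.
Qed.

End Weighted.

Section Independence.
Context d (T : measurableType d) (R : realType) (P : probability T R).
Variables (m : nat) (X : 'I_m -> {RV P >-> R}).

Lemma bounded_integrable (Y : T -> R) (M : R) :
  measurable_fun setT Y -> (forall w, `|Y w| <= M) ->
  P.-integrable setT (EFin \o Y).
Proof.
move=> mY YM; apply: (le_integrable measurableT (f := EFin \o Y) (g := EFin \o cst M)) => //.
- exact/measurable_EFinP.
- by move=> w _ /=; rewrite lee_fin; apply: (le_trans (YM w)); exact: ler_norm.
- exact: finite_measure_integrable_cst.
Qed.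

Hypothesis indX : mutually_independent X.

(* Induction on the number of coordinates carrying [F] instead of an indicator. *)
Lemma expectation_prod_indep (F : R -> R) (M : R) :
  measurable_fun setT F -> (forall x, 0 <= F x) ->
  (forall j w, F (X j w) <= M) ->
  (\int[P]_w (\prod_(j < m) F (X j w))%:E =
   (\prod_(j < m) \int[P]_w F (X j w))%:E)%E.
Proof.
move=> mF F0 FM.
have mFX j : measurable_fun setT (F \o X j) by exact: measurableT_comp.
have iFX j : P.-integrable setT (EFin \o (F \o X j)).
  apply: (bounded_integrable (M := M)) => // w /=.
  by rewrite ger0_norm.
suff H k : (k <= m)%N -> forall B : 'I_m -> set R, (forall j, measurable (B j)) ->
    (\int[P]_w (\prod_(j < m) (if (j < k)%N then F (X j w) else \1_(B j) (X j w)))%:E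
     = (\prod_(j < m) (if (j < k)%N then \int[P]_w F (X j w)
                       else fine (P (X j @^-1` B j))))%:E)%E.
  have := H m (leqnn m) (fun=> setT) (fun=> measurableT).
  under eq_integral do under eq_bigr do rewrite ltn_ord.
  by under [in RHS]eq_bigr do rewrite ltn_ord.
elim: k => [_ B mB|k IH km B mB].
  under eq_integral.
    move=> w _.
    have -> : \prod_(j < m) (if (j < 0)%N then F (X j w) else \1_(B j) (X j w)) =
        \1_(\bigcap_(j in [set` [set: 'I_m]%SET]) (X j @^-1` B j)) w :> R.
      rewrite indicE; case: (boolP (w \in _)) => [/set_mem wB|/negP wB].
        by apply: big1 => j _; rewrite /= indicE mem_set//; apply: wB; rewrite /= finset.in_setT.
      have [j Hj] : exists j, ~ B j (X j w).
        apply/existsNP => wB'; apply: wB; apply/mem_set => j _; exact: wB'.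
      by rewrite (bigD1 j)//= indicE memNset// mul0r.
    over.
  rewrite integral_indic//; last first.
    by apply: fin_bigcap_measurable => // j _; exact: measurable_funPTI.
  rewrite setIT; transitivity (\prod_(j in [set: 'I_m]%SET) P (X j @^-1` B j))%E.
    exact: indX.
  rewrite big_mkcond -prodEFin; apply: eq_bigr => j _.
  by rewrite finset.in_setT /= fineK// fin_num_measure//; exact: measurable_funPTI.
pose kk := Ordinal km.
pose G w := \prod_(j < m | j != kk) (if (j < k)%N then F (X j w) else \1_(B j) (X j w)).
pose c := \prod_(j < m | j != kk) (if (j < k)%N then \int[P]_w F (X j w)
                       else fine (P (X j @^-1` B j))).
have c0 : 0 <= c.
  apply: prodr_ge0 => j _; case: ifP => _; last by rewrite fine_ge0.
  by apply: Rintegral_ge0.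
have neq j : (j != kk) -> (j < k.+1)%N = (j < k)%N.
  by rewrite -(inj_eq val_inj)/= => jk; rewrite ltnS leq_eqVlt (negPf jk).
have mfac (j : 'I_m) : measurable_fun setT (fun w => if (j < k)%N then F (X j w) else \1_(B j) (X j w)).
  by case: (j < k)%N; [exact: mFX|exact: measurableT_comp].
have mG : measurable_fun setT G.
  rewrite /G; under eq_fun do rewrite -big_filter.
  exact: measurable_prod.
have G0 w : 0 <= G w.
  by apply: prodr_ge0 => j _; case: ifP.
transitivity (\int[P]_w (G w * F (X kk w))%:E)%E.
  apply: eq_integral => w _; rewrite (bigD1 kk)//= ltnSn mulrC; congr ((_ * _)%:E).
  by apply: eq_bigr => j jk; rewrite neq.
(* The induction hypothesis holds for every choice of [B]; varying the entry [kk] shows that the law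
   of [X kk] under the weight [G] is [c] times its plain law. *)
rewrite (@integral_weighted_pushforward _ _ _ _ _ measurableT G (X kk)
  (mscale (NngNum c0) (distribution P (X kk)))) //; last first.
  move=> A mA; have := IH (ltnW km) (fun j => if j == kk then A else B j).
  rewrite /mscale /=.
  under eq_integral.
    move=> w _; rewrite (bigD1 kk)//= ltnn eqxx mulrC.
    under eq_bigr => j jk do rewrite (negPf jk).
    over.
  move=> ->; last by move=> j; case: ifP.
  rewrite (bigD1 kk)//= ltnn eqxx mulrC EFinM.
  under eq_bigr => j jk do rewrite (negPf jk).
  by rewrite fineK// fin_num_measure//; exact: measurable_funPTI.
have mEF : measurable_fun setT (EFin \o F) by exact/measurable_EFinP.
rewrite ge0_integral_mscale//=; last by move=> x _; rewrite lee_fin.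
rewrite ge0_integral_distribution//.
rewrite [in RHS](bigD1 kk)//= ltnSn mulrC EFinM; congr (_%:E * _)%E.
  by apply: eq_bigr => j jk; rewrite neq.
rewrite /Rintegral fineK//.
exact: (integrable_fin_num _ (iFX kk)).
Qed.

End Independence.

(** * Concentration *)

Section Concentration.
Context d (T : measurableType d) (R : realType) (P : probability T R).

Lemma with_prob_ge_le (r r' : R) (Q Q' : T -> Prop) :
  r' <= r -> (forall w, Q w -> Q' w) -> with_prob_ge P r Q -> with_prob_ge P r' Q'.
Proof.
move=> rr QQ [E [mE PE EQ]]; exists E; split => //; last by move=> w /EQ/QQ.
by apply: le_trans PE; rewrite lee_fin.
Qed.

Lemma with_prob_ge_compl (E : set T) (r : R) (Q : T -> Prop) : measurable E ->
  (P E <= r%:E)%E -> (forall w, ~ E w -> Q w) -> with_prob_ge P (1 - r) Q.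
Proof.
move=> mE PE EQ; exists (~` E); split => //; first exact: measurableC.
by rewrite probability_setC// EFinB leeB.
Qed.

Lemma with_prob_geI (r1 r2 : R) (Q1 Q2 : T -> Prop) :
  with_prob_ge P (1 - r1) Q1 -> with_prob_ge P (1 - r2) Q2 ->
  with_prob_ge P (1 - (r1 + r2)) (fun w => Q1 w /\ Q2 w).
Proof.
have H (E : set T) (r : R) : measurable E ->
    ((1 - r)%:E <= P E)%E -> (P (~` E) <= r%:E)%E.
  move=> mE PE; rewrite probability_setC//.
  by rewrite -[r%:E]/(r%:E) leeBlDr ?fin_num_measure// addeC -leeBlDr// -EFinB.
move=> [E1 [m1 p1 q1]] [E2 [m2 p2 q2]].
apply: (@with_prob_ge_compl (~` E1 `|` ~` E2)).
- by apply: measurableU; exact: measurableC.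
- apply: (le_trans (measureU2 _ _ _)); [exact: measurableC|exact: measurableC|].
  by rewrite EFinD leeD// H.
- by move=> w; rewrite -setCI => /contrapT [/q1 ? /q2 ?].
Qed.

Lemma with_prob_ge_all (I : finType) (r : I -> R) (Q : I -> T -> Prop) :
  (forall i, with_prob_ge P (1 - r i) (Q i)) ->
  with_prob_ge P (1 - \sum_i r i) (fun w => forall i, Q i w).
Proof.
move=> H; suff HS (s : seq I) :
    with_prob_ge P (1 - \sum_(i <- s) r i) (fun w => forall i, i \in s -> Q i w).
  apply: with_prob_ge_le (HS (index_enum I)) => // w Qw i.
  by apply: Qw; rewrite mem_index_enum.
elim: s => [|i s IH].
  rewrite big_nil; exists setT; split => //.
  by rewrite probability_setT subr0.
rewrite big_cons; apply: with_prob_ge_le (with_prob_geI (H i) IH) => // w [Qi Qs] j.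
by rewrite inE => /predU1P[->//|]; exact: Qs.
Qed.

Variables (m : nat) (X : 'I_m -> {RV P >-> R}).
Hypothesis indX : mutually_independent X.

(** Markov's inequality for [expR (Y w)], whose mean factors by independence. Centering and scale
    are contained in [u], so each deviation bound reduces to one inequality for the mean of
    [expR u]. *)
Lemma exp_moment_tail (u : R -> R) (M lam : R) :
  measurable_fun setT u -> (forall j w, u (X j w) <= M) ->
  (forall j, \int[P]_w expR (u (X j w)) <= 1) ->
  with_prob_ge P (1 - expR (- lam)) (fun w => \sum_(j < m) u (X j w) < lam).
Proof.
move=> mu uM u1.
pose Y w := \sum_(j < m) u (X j w).
have mY : measurable_fun setT Y.
  by apply: measurable_sum => j; exact: measurableT_comp.
pose A := [set w | lam <= Y w].
have mA : measurable A.
  rewrite -[X in measurable X]setTI /A; apply: (measurable_fun_le measurableT) => //.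
apply: (@with_prob_ge_compl A) => //; last first.
  by move=> w /negP; rewrite -ltNge.
have L1 : (\int[P]_w (expR (Y w))%:E <= 1)%E.
  under eq_integral do rewrite /Y expR_sum.
  rewrite (expectation_prod_indep indX (F := expR \o u) (M := expR M))//=.
  - rewrite lee_fin; apply: prodr_ile1 => j _; rewrite u1 andbT.
    by apply: Rintegral_ge0 => w _; exact: expR_ge0.
  - exact: measurableT_comp.
  - by move=> j w; rewrite ler_expR.
have : ((expR lam)%:E * P A <= 1)%E.
  apply: le_trans L1; rewrite -[X in P X]setIT -integral_indic// -ge0_integralZl//.
  - apply: ge0_le_integral => //.
    + by apply/measurable_EFinP; apply: measurable_funM.
    + by apply/measurable_EFinP; exact: measurableT_comp.
    + move=> w _; rewrite -EFinM lee_fin indicE; case: (boolP (w \in _)) => [/set_mem /= l|_].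
        by rewrite mulr1 ler_expR.
      by rewrite mulr0 expR_ge0.
  - exact/measurable_EFinP.
by rewrite expRN -lee_pdivlMl ?expR_gt0// mule1.
Qed.

End Concentration.

(** * Dyadic levels *)

Section Levels.
Context {R : realType}.
Implicit Types (K c u v z : R) (i n : nat).

Definition lev K i : R := K * 2 ^+ i.

(* Truncated square at level 0, and a threshold indicator of height
   [lev K i ^+ 2] at level [i > 0]; summing over levels recovers [u ^+ 2] up
   to constants (sum_thr1_le, sqr_le_sum_thr2). *)
Definition thr c K i u : R :=
  if i is 0 then Num.min (u ^+ 2) (16 * K ^+ 2)
  else if c * lev K i <= `|u| then lev K i ^+ 2 else 0.

Definition dev K i z : R :=
  if i is 0 then z ^+ 2
  else if 2^-1 * lev K i <= `|z| then lev K i ^+ 2 else 0.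

Lemma thr_ge0 c K i u : 0 <= thr c K i u.
Proof.
case: i => [|i] /=; last by case: ifP => // _; exact: sqr_ge0.
by rewrite le_min sqr_ge0 mulr_ge0 ?sqr_ge0.
Qed.

Lemma dev_ge0 K i z : 0 <= dev K i z.
Proof. by case: i => [|i] /=; [|case: ifP => // _]; exact: sqr_ge0. Qed.

Lemma devN K i z : dev K i (- z) = dev K i z.
Proof. by case: i => [|i] /=; rewrite ?sqrrN ?normrN. Qed.

Lemma thr_le c K i u : thr c K i u <= 16 * K ^+ 2 * 4 ^+ i.
Proof.
have K0 := sqr_ge0 K.
case: i => [|i] /=; first by rewrite expr0 mulr1 ge_min lexx orbT.
have h4 : (0 : R) <= 4 ^+ i.+1 by rewrite exprn_ge0.
have -> : lev K i.+1 ^+ 2 = K ^+ 2 * 4 ^+ i.+1.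
  by rewrite /lev exprMn -exprM mulnC exprM; congr (_ * _ ^+ _); ring.
have := mulr_ge0 K0 h4.
by case: ifP => _; nra.
Qed.

(** For [i > 0]: if [|u|] reaches [c' t], then [|v|] reaches [c t] or [|v - u|] reaches [t / 2]. For
    [i = 0] it is [(x + y)^2 <= 2 x^2 + 2 y^2] under a common cap. *)
Lemma thr_dev c c' K i u v : 0 <= K -> c + 2^-1 <= c' ->
  thr c' K i u <= 2 * thr c K i v + 2 * dev K i (v - u).
Proof.
move=> K0 cc'.
case: i => [|i] /=.
  have Hu : u ^+ 2 <= 2 * v ^+ 2 + 2 * (v - u) ^+ 2 by have := sqr_ge0 (2 * v - u); nra.
  have := sqr_ge0 (v - u) => H2; have := sqr_ge0 K => HK.
  have [_|_] := leP (v ^+ 2) (16 * K ^+ 2); rewrite ge_min; first by rewrite Hu.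
  by apply/orP; right; lra.
have t0 : 0 <= lev K i.+1 by rewrite mulr_ge0// exprn_ge0.
have s0 := sqr_ge0 (lev K i.+1).
case: ifP => [h1|_]; case: ifP => h2; case: ifP => h3; try lra.
move: h2 h3 => /negbT; rewrite -ltNge => h2 /negbT; rewrite -ltNge => h3.
have : `|u| <= `|v| + `|v - u|.
  by rewrite -[X in `|X| <= _](subKr v) -[v - (v - u)]addrC addrC; exact: ler_normB.
have : (c + 2^-1) * lev K i.+1 <= c' * lev K i.+1 by rewrite ler_wpM2r.
lra.
Qed.

(** The heights of the active levels grow by the ratio 4, so their sum is at most [4/3] of the last
    one, itself at most [u ^+ 2]; level 0 adds at most one more [u ^+ 2]. *)
Lemma sum_thr1_le K n u : 0 <= K -> \sum_(i < n.+1) thr 1 K i u <= 3 * u ^+ 2.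
Proof.
move=> K0; rewrite big_ord_recl /=.
have u0 := sqr_ge0 u.
have H0 : Num.min (u ^+ 2) (16 * K ^+ 2) <= u ^+ 2 by rewrite ge_min lexx.
pose S n := \sum_(i < n) thr 1 K (lift ord0 i) u.
have levS k : lev K k.+1 ^+ 2 = 4 * lev K k ^+ 2 by rewrite /lev [2 ^+ _.+1]exprS; ring.
have SS k : S k.+1 = S k + thr 1 K k.+1 u.
  by rewrite /S big_ord_recr /=.
have H1 k : S k <= 4 / 3 * lev K k ^+ 2.
  elim: k => [|k IH]; first by rewrite /S big_ord0 mulr_ge0// sqr_ge0.
  rewrite SS /= levS; have := sqr_ge0 (lev K k).
  by case: ifP => _; lra.
suff H2 k : S k <= 4 / 3 * u ^+ 2 by have := H2 n; rewrite /S; lra.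
elim: k => [|k IH]; first by rewrite /S big_ord0 mulr_ge0// sqr_ge0.
rewrite SS /=; case: ifP => [|_]; last by rewrite addr0.
have t0 : 0 <= lev K k.+1 by rewrite mulr_ge0// exprn_ge0.
rewrite mul1r => /(lerXn2r 2 t0 (normr_ge0 u)); rewrite real_normK ?num_real// => h.
have := H1 k; have := levS k; lra.
Qed.

(** If [|u|] exceeds [2 lev] at the top level, it is still at most [4 lev], so this level alone
    gives [u ^+ 2 / 16]; otherwise the induction hypothesis applies. In the base case [|u| <= 4 K],
    and the cap [16 K^2] has no effect. *)
Lemma sqr_le_sum_thr2 K n u : 0 <= K -> `|u| <= K * 2 ^+ n.+2 ->
  u ^+ 2 <= 16 * \sum_(i < n.+1) thr 2 K i u.
Proof.
move=> K0; have u2 x : 0 <= x -> `|u| <= x -> u ^+ 2 <= x ^+ 2.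
  by move=> x0 h; rewrite -[u ^+ 2]real_normK ?num_real// lerXn2r// nnegrE.
elim: n => [|n IH] hu.
  rewrite big_ord_recl big_ord0 addr0 /=.
  have := u2 _ (mulr_ge0 K0 (exprn_ge0 2 (ler0n R 2))) hu.
  have -> : (K * 2 ^+ 2) ^+ 2 = 16 * K ^+ 2 by ring.
  by move=> ?; have ? := sqr_ge0 u; have ? := sqr_ge0 K; have [?|?] := leP (u ^+ 2) (16 * K ^+ 2); lra.
have [/IH h|h] := leP `|u| (K * 2 ^+ n.+2).
  by rewrite big_ord_recr /=; have := thr_ge0 2 K n.+1 u; rewrite /=; lra.
rewrite big_ord_recr /=.
have h0 : 0 <= \sum_(i < n.+1) thr 2 K i u by apply: sumr_ge0 => i _; exact: thr_ge0.
have -> : 2 * lev K n.+1 <= `|u|.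
  by move: h; rewrite /lev exprS; lra.
have := u2 _ (mulr_ge0 K0 (exprn_ge0 n.+3 (ler0n R 2))) hu.
have -> : (K * 2 ^+ n.+3) ^+ 2 = 16 * lev K n.+1 ^+ 2.
  by rewrite /lev (exprS 2 n.+2) (exprS 2 n.+1); ring.
lra.
Qed.

(** Compare after multiplication by [1 - x]: [(1 - x) expR x <= 1], while [(1 - x)(1 + x + 2 x^2) =
    1 + x^2 (1 - 2 x)]. *)
Lemma expR_le_quad (x : R) : x <= 2^-1 -> expR x <= 1 + x + 2 * x ^+ 2.
Proof.
move=> x2; have := expR_ge1Dx (- x); rewrite expRN => h.
have e0 := expR_gt0 x; have h2 : (1 - x) * expR x <= 1.
  by rewrite -[leRHS](mulVf (lt0r_neq0 e0)) ler_pM2r.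
have : 0 <= x ^+ 2 * (1 - 2 * x) by rewrite mulr_ge0 ?sqr_ge0//; lra.
nra.
Qed.

Lemma expRB1_le (x : R) : expR x - 1 <= x * expR x.
Proof.
have := expR_ge1Dx (- x); rewrite expRN => h; have e0 := expR_gt0 x.
have : (1 - x) * expR x <= (expR x)^-1 * expR x by rewrite ler_pM2r.
rewrite mulVf ?gt_eqF//; lra.
Qed.

(** This is [2 (cosh z - 1)]. It vanishes to second order at 0, so its mean under the sampling is
    proportional to the variance, and it grows exponentially on both sides; a plain exponential
    moment would lose the variance factor. *)
Definition cosh2 (z : R) := expR z + expR (- z) - 2.

Lemma cosh2_ge_sqr z : z ^+ 2 <= 4 * cosh2 z.
Proof.
wlog z0 : z / 0 <= z => [H|].
  have [/H//|/ltW z0] := leP 0 z.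
  by have := H (- z); rewrite oppr_ge0 z0 sqrrN /cosh2 opprK => /(_ isT); lra.
have h1 := expR_ge1Dx (- z).
have h2 := expR_ge1Dx (z / 2).
have h3 : expR z = expR (z / 2) ^+ 2 by rewrite -expRM_natl; congr expR; field.
rewrite /cosh2 h3; nra.
Qed.

Lemma cosh2_ge0 z : 0 <= cosh2 z.
Proof. by have := cosh2_ge_sqr z; have := sqr_ge0 z; lra. Qed.

Lemma cosh2_ge_expR (y z : R) : 4 <= expR y -> y <= `|z| -> expR y <= 2 * cosh2 z.
Proof.
move=> y4; have := expR_gt0 z; have := expR_gt0 (- z).
case: (ger0P z) => z0 ? ?; rewrite -ler_expR /cosh2; lra.
Qed.

End Levels.

(** * Maurey's sampling *)

Section Maurey.
Context {R : realType} (J : finType) (n : nat).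
Variables (p y : J -> R) (C : R).
Hypotheses (p0 : forall j, 0 <= p j) (p1 : \sum_j p j = 1).
Hypotheses (yC : forall j, `|y j| <= C) (n0 : (0 < n)%N).

(** Law of [n] independent draws from [p]. Expectations under the sampling are finite weighted sums,
    the form in which [mean_on] can be applied to them. *)
Definition prod_weight (tau : {ffun 'I_n -> J}) : R := \prod_l p (tau l).

Lemma prod_weight_ge0 tau : 0 <= prod_weight tau.
Proof. exact: prodr_ge0. Qed.

Lemma sum_prod_weightM (f : J -> R) :
  \sum_tau prod_weight tau * \prod_l f (tau l) = (\sum_j p j * f j) ^+ n.
Proof.
rewrite -[in RHS](card_ord n) -prodr_const bigA_distr_bigA /=.
by apply: eq_bigr => tau _; rewrite -big_split.
Qed.

Lemma sum_prod_weight : \sum_tau prod_weight tau = 1.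
Proof.
transitivity ((\sum_j p j * 1) ^+ n); last first.
  by under eq_bigr do rewrite mulr1; rewrite p1 expr1n.
by rewrite -(sum_prod_weightM (fun=> 1)); apply: eq_bigr => tau _; rewrite big1// mulr1.
Qed.

Let g := \sum_j p j * y j.
Let V := \sum_j p j * y j ^+ 2.

Definition emp_dev (tau : {ffun 'I_n -> J}) : R := n%:R^-1 * \sum_l y (tau l) - g.

Let C0 : 0 <= C.
Proof.
have [j _|J0] := pickP (fun _ : J => true); first exact: le_trans (yC j).
by move: p1; rewrite big_pred0// => /eqP; rewrite eq_sym oner_eq0.
Qed.

Let gC : `|g| <= C.
Proof.
apply: (le_trans (ler_norm_sum _ _ _)).
rewrite -[leRHS]mul1r -p1 mulr_suml; apply: ler_sum => j _.
by rewrite normrM ger0_norm// ler_wpM2l.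
Qed.

Lemma emp_var_le : V <= C ^+ 2.
Proof.
rewrite -[leRHS]mul1r -p1 mulr_suml; apply: ler_sum => j _.
by rewrite ler_wpM2l// -[y j ^+ 2]real_normK ?num_real// lerXn2r// nnegrE.
Qed.

Lemma emp_var_ge0 : 0 <= V.
Proof. by apply: sumr_ge0 => j _; rewrite mulr_ge0// sqr_ge0. Qed.

(** The moment factors over the draws, and [expR_le_quad] applies to each factor: [|y j - g| <= 2 C]
    and the condition on [th] keep its argument below [1/2]. Centering removes the first-order
    term. *)
Lemma emp_dev_mgf (th : R) : `|th| * (4 * C) <= n%:R ->
  \sum_tau prod_weight tau * expR (th * emp_dev tau) <= expR (2 * (th ^+ 2 * V / n%:R)).
Proof.
move=> thC; have nR : 0 < n%:R :> R by rewrite ltr0n.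
pose ze := th / n%:R.
have zeC : `|ze| * (4 * C) <= 1.
  by rewrite normrM normfV (ger0_norm (ltW nR)) mulrAC ler_pdivrMr// mul1r.
have -> : \sum_tau prod_weight tau * expR (th * emp_dev tau) =
    (\sum_j p j * expR (ze * (y j - g))) ^+ n.
  rewrite -sum_prod_weightM; apply: eq_bigr => tau _; congr (_ * _).
  rewrite -expR_sum -mulr_sumr sumrB sumr_const card_ord; congr expR.
  by rewrite /emp_dev /ze -mulr_natr; field; rewrite gt_eqF.
have -> : 2 * (th ^+ 2 * V / n%:R) = n%:R * (2 * ze ^+ 2 * V).
  by rewrite /ze; field; rewrite gt_eqF.
rewrite expRM_natl lerXn2r ?nnegrE ?expR_ge0//.
  by apply: sumr_ge0 => j _; rewrite mulr_ge0// expR_ge0.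
apply: le_trans (expR_ge1Dx _).
(* The centered second moment is [V - g^2]; the surplus [2 ze^2 g^2] is nonnegative. *)
have -> : 1 + 2 * ze ^+ 2 * V =
    \sum_j p j * (1 + ze * (y j - g) + 2 * (ze * (y j - g)) ^+ 2) + 2 * ze ^+ 2 * g ^+ 2.
  have E j : p j * (1 + ze * (y j - g) + 2 * (ze * (y j - g)) ^+ 2) =
     (1 - ze * g + 2 * ze ^+ 2 * g ^+ 2) * p j + (ze - 4 * ze ^+ 2 * g) * (p j * y j)
     + 2 * ze ^+ 2 * (p j * y j ^+ 2) by ring.
  under eq_bigr do rewrite E.
  by rewrite 2!big_split /= -3!mulr_sumr p1 -/g -/V; ring.
rewrite -[leLHS]addr0; apply: lerD; last by rewrite mulr_ge0 ?sqr_ge0// mulr_ge0 ?sqr_ge0.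
apply: ler_sum => j _; rewrite ler_wpM2l//; apply: expR_le_quad.
apply: (le_trans (ler_norm _)); rewrite normrM.
have : `|y j - g| <= 2 * C by apply: (le_trans (ler_normB _ _)); have := yC j; have := gC; lra.
move=> h; have : `|ze| * `|y j - g| <= `|ze| * (2 * C) by rewrite ler_wpM2l.
lra.
Qed.

(** [expRB1_le] keeps one factor [V] in front, and only the [V] inside the exponential is replaced
    by [C ^+ 2]; the bound can thus still be averaged over the points. *)
Lemma emp_dev_cosh2 (th : R) : `|th| * (4 * C) <= n%:R ->
  \sum_tau prod_weight tau * cosh2 (th * emp_dev tau)
  <= 4 * (th ^+ 2 * V / n%:R) * expR (2 * (th ^+ 2 * C ^+ 2 / n%:R)).
Proof.
move=> thC; have nR : 0 < n%:R :> R by rewrite ltr0n.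
have h1 := emp_dev_mgf thC.
have h2 : \sum_tau prod_weight tau * expR (- (th * emp_dev tau))
    <= expR (2 * (th ^+ 2 * V / n%:R)).
  have := @emp_dev_mgf (- th); rewrite normrN sqrrN => /(_ thC).
  by under eq_bigr do rewrite mulNr.
set x := 2 * (th ^+ 2 * V / n%:R).
have x0 : 0 <= x.
  by rewrite mulr_ge0// divr_ge0 ?ler0n// mulr_ge0 ?sqr_ge0// emp_var_ge0.
have xx : x <= 2 * (th ^+ 2 * C ^+ 2 / n%:R).
  by rewrite ler_pM2l// ler_pM2r ?invr_gt0// ler_wpM2l ?sqr_ge0// emp_var_le.
apply: (@le_trans _ _ (2 * (expR x - 1))).
  rewrite /cosh2; under eq_bigr do rewrite mulrBr mulrDr.
  by rewrite sumrB big_split /= -mulr_suml sum_prod_weight; rewrite -/x in h1 h2; lra.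
have -> : 4 * (th ^+ 2 * V / n%:R) = 2 * x by rewrite /x; ring.
rewrite -mulrA ler_pM2l//; apply: (le_trans (expRB1_le _)).
by rewrite ler_wpM2l// ler_expR.
Qed.

(** Read off from the [cosh2] bound at [th = 1 / (4 C)], the largest value allowed for every [n];
    there the exponential factor is at most 2, and [32 = 4 * 4 * 2]. The case [C = 0] is trivial. *)
Lemma emp_dev_sqr : \sum_tau prod_weight tau * emp_dev tau ^+ 2 <= 32 * V / n%:R.
Proof.
have nR : 1 <= n%:R :> R by rewrite ler1n.
have [C00|Cn0] := eqVneq C 0.
  have y0 j : y j = 0 by apply/eqP; rewrite -normr_le0 -C00.
  rewrite big1.
    by rewrite divr_ge0 ?ler0n// mulr_ge0// emp_var_ge0.
  move=> tau _; rewrite /emp_dev /g big1; last by move=> l _.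
  by rewrite big1 ?mulr0 ?subrr ?expr0n ?mulr0//= => j _; rewrite y0 mulr0.
have Cp : 0 < C by rewrite lt0r Cn0 C0.
pose th := (4 * C)^-1.
have th0 : 0 < th by rewrite invr_gt0 mulr_gt0.
have := @emp_dev_cosh2 th; rewrite (ger0_norm (ltW th0)) /th mulVf; last by rewrite mulf_neq0// pnatr_eq0.
move=> /(_ nR); rewrite -/th => h.
have nn : 0 < (n%:R^-1 : R) <= 1 by rewrite invr_gt0 (lt_le_trans ltr01)//= invf_le1// (lt_le_trans ltr01).
have e2 : expR (2 * (th ^+ 2 * C ^+ 2 / n%:R)) <= 2.
  apply: (@le_trans _ _ (expR 2^-1)).
    rewrite ler_expR; have -> : 2 * (th ^+ 2 * C ^+ 2 / n%:R) = 8^-1 * n%:R^-1.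
      by rewrite /th; field; rewrite Cn0 gt_eqF// (lt_le_trans ltr01).
    by move/andP: nn => [? ?]; lra.
  have := @expR_le_quad R 2^-1 (lexx _); lra.
have h3 : \sum_tau prod_weight tau * emp_dev tau ^+ 2 <=
    4 / th ^+ 2 * \sum_tau prod_weight tau * cosh2 (th * emp_dev tau).
  rewrite mulr_sumr; apply: ler_sum => tau _.
  rewrite [leRHS]mulrCA ler_wpM2l ?prod_weight_ge0//.
  have := cosh2_ge_sqr (th * emp_dev tau); rewrite exprMn => h4.
  by rewrite mulrAC ler_pdivlMr ?exprn_gt0// mulrC.
apply: (le_trans h3).
have c0 : 0 <= 4 / th ^+ 2 by rewrite divr_ge0// sqr_ge0.
apply: (le_trans (ler_wpM2l c0 h)).
have -> : 4 / th ^+ 2 * (4 * (th ^+ 2 * V / n%:R) * expR (2 * (th ^+ 2 * C ^+ 2 / n%:R)))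
  = (V / n%:R) * 16 * expR (2 * (th ^+ 2 * C ^+ 2 / n%:R)).
  by rewrite /th; field; rewrite Cn0 gt_eqF// (lt_le_trans ltr01).
have -> : 32 * V / n%:R = (V / n%:R) * 16 * 2 by ring.
by rewrite ler_wpM2l// mulr_ge0// divr_ge0 ?emp_var_ge0.
Qed.

Lemma emp_dev_tail (t be : R) : 0 < C -> 0 < t <= 2 * C ->
  n%:R * t ^+ 2 = be * C ^+ 2 -> 32 <= be ->
  \sum_tau prod_weight tau * (if 2^-1 * t <= `|emp_dev tau| then t ^+ 2 else 0)
  <= be / 8 * (t ^+ 2 / C ^+ 2) * expR (- (be / 32)) * V.
Proof.
move=> Cp /andP[t0 tC] nbe be32; have nR : 0 < n%:R :> R by rewrite ltr0n.
have Cn0 : C != 0 by rewrite gt_eqF.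
(* With this choice [th t / 2 = be / 16], while the exponent in [emp_dev_cosh2] is [be / 32], so
   [exp (- be / 32)] survives. [be >= 32] gives the [4 <= expR (be / 16)] that [cosh2_ge_expR]
   requires. *)
pose th := n%:R * t / (8 * C ^+ 2).
have th0 : 0 < th by rewrite divr_gt0 ?mulr_gt0 ?exprn_gt0.
have nE : n%:R = be * C ^+ 2 / t ^+ 2 by rewrite -nbe; field; rewrite gt_eqF.
have h0 : `|th| * (4 * C) <= n%:R.
  rewrite (ger0_norm (ltW th0)).
  have -> : th * (4 * C) = n%:R * (t / (2 * C)) by rewrite /th; field.
  by rewrite -[leRHS]mulr1 ler_pM2l// ler_pdivrMr ?mul1r// mulr_gt0.
have h1 := emp_dev_cosh2 h0.
have e4 : 4 <= expR (be / 16).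
  have : expR (1 + 1) <= expR (be / 16) by rewrite ler_expR; lra.
  rewrite expRD; have := expR_ge1Dx (1 : R); nra.
have h2 : \sum_tau prod_weight tau * (if 2^-1 * t <= `|emp_dev tau| then t ^+ 2 else 0)
   <= 2 * t ^+ 2 * expR (- (be / 16)) * \sum_tau prod_weight tau * cosh2 (th * emp_dev tau).
  rewrite mulr_sumr; apply: ler_sum => tau _.
  rewrite [leRHS]mulrCA ler_wpM2l ?prod_weight_ge0//.
  case: ifP => [hh|_]; last first.
    by rewrite !mulr_ge0 ?cosh2_ge0 ?expR_ge0// ?sqr_ge0 ?ltW.
  have : be / 16 <= `|th * emp_dev tau|.
    rewrite normrM (ger0_norm (ltW th0)).
    have -> : be / 16 = th * (2^-1 * t).
      by rewrite /th nE; field; rewrite Cn0 gt_eqF.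
    by rewrite ler_pM2l.
  move=> /(cosh2_ge_expR e4) h.
  rewrite expRN.
  have -> : 2 * t ^+ 2 * (expR (be / 16))^-1 * cosh2 (th * emp_dev tau)
    = t ^+ 2 * (2 * cosh2 (th * emp_dev tau) / expR (be / 16)) by ring.
  by rewrite -[leLHS]mulr1 ler_wpM2l ?sqr_ge0// ler_pdivlMr ?expR_gt0// mul1r.
apply: (le_trans h2).
have c0 : 0 <= 2 * t ^+ 2 * expR (- (be / 16)) by rewrite !mulr_ge0 ?expR_ge0// ltW.
apply: (le_trans (ler_wpM2l c0 h1)).
have -> : 2 * (th ^+ 2 * C ^+ 2 / n%:R) = be / 32.
  by rewrite /th nE; field; rewrite Cn0 !gt_eqF// ; lra.
have -> : th ^+ 2 * V / n%:R = be / 64 / C ^+ 2 * V.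
  by rewrite /th nE; field; rewrite Cn0 !gt_eqF// ; lra.
have -> : expR (- (be / 16)) = expR (- (be / 32)) / expR (be / 32).
  by rewrite -expRN -expRD; congr expR; field.
rewrite le_eqVlt; apply/orP; left; apply/eqP; field.
by rewrite Cn0 gt_eqF ?expR_gt0.
Qed.

End Maurey.

(** * The restricted eigenvalue bound: deterministic part *)

Section Functionals.
Context {R : realType}.
Implicit Types (a b : R) (F G : R -> R).

Definition bdd_borel a b F : Prop :=
  measurable_fun setT F /\ exists M, forall x, a <= x <= b -> `|F x| <= M.

(* Common abstraction of the mean with respect to nu and the empirical mean. *)
Definition mean_on a b (L : (R -> R) -> R) : Prop :=
  forall (I J : finType) (c : I -> R) (F : I -> R -> R) (e : J -> R) (G : J -> R -> R),
    (forall i, bdd_borel a b (F i)) -> (forall j, bdd_borel a b (G j)) ->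
    (forall x, a <= x <= b -> \sum_i c i * F i x <= \sum_j e j * G j x) ->
    \sum_i c i * L (F i) <= \sum_j e j * L (G j).

Lemma measurable_horner (p : {poly R}) : measurable_fun setT (horner p).
Proof. by apply: continuous_measurable_fun; exact: continuous_horner. Qed.

Lemma measurable_thr (c K : R) i : measurable_fun setT (thr c K i).
Proof.
case: i => [|i] /=.
  by apply: measurable_minr => //; exact: measurable_funX.
apply: measurable_fun_ifT => //; exact: measurable_fun_ler.
Qed.

Lemma measurable_dev (K : R) i : measurable_fun setT (dev K i).
Proof.
case: i => [|i] /=; first exact: measurable_funX.
apply: measurable_fun_ifT => //; exact: measurable_fun_ler.
Qed.

Lemma bdd_borel_horner_sqr a b (p : {poly R}) : bdd_borel a b (fun x => p.[x] ^+ 2).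
Proof.
split; first by apply: measurable_funX; exact: measurable_horner.
have [M HM] := poly_itv_bound p a b; exists (M ^+ 2) => x /HM h.
by rewrite normrX lerXn2r// ?nnegrE//; apply: le_trans h.
Qed.

Lemma bdd_borel_thr a b (c K : R) i (p : {poly R}) : bdd_borel a b (fun x => thr c K i p.[x]).
Proof.
split; first by apply: measurableT_comp; [exact: measurable_thr|exact: measurable_horner].
by exists (16 * K ^+ 2 * 4 ^+ i) => x _; rewrite ger0_norm ?thr_ge0// thr_le.
Qed.

Lemma bdd_borel_dev a b (K : R) i (p : {poly R}) : bdd_borel a b (fun x => dev K i p.[x]).
Proof.
case: i => [|i]; first exact: bdd_borel_horner_sqr.
split; first by apply: measurableT_comp; [exact: measurable_dev|exact: measurable_horner].
exists (lev K i.+1 ^+ 2) => x _ /=; have h := sqr_ge0 (lev K i.+1).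
by case: ifP => _; rewrite ?normr0// ger0_norm.
Qed.

Lemma sum_unit (F : unit -> R) : \sum_i F i = F tt.
Proof. by rewrite (bigD1 tt)//= big_pred0 ?addr0// => -[]. Qed.

Variables (a b : R) (L : (R -> R) -> R).
Hypothesis meanL : mean_on a b L.

Lemma mean_on_le (F G1 G2 : R -> R) (e1 e2 : R) :
  bdd_borel a b F -> bdd_borel a b G1 -> bdd_borel a b G2 ->
  (forall x, a <= x <= b -> F x <= e1 * G1 x + e2 * G2 x) -> L F <= e1 * L G1 + e2 * L G2.
Proof.
move=> bF bG1 bG2 FG.
have := @meanL unit bool (fun=> 1) (fun=> F)
  (fun s : bool => if s then e1 else e2) (fun s : bool => if s then G1 else G2).
rewrite big_bool sum_unit mul1r; apply => //; first by case.
by move=> x xab; rewrite big_bool sum_unit mul1r FG.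
Qed.

Lemma mean_on_ge0 (F : R -> R) : bdd_borel a b F ->
  (forall x, a <= x <= b -> 0 <= F x) -> 0 <= L F.
Proof.
(* The empty index type [void] turns the left-hand combination into 0. *)
move=> bF F0; have := @meanL void unit (fun=> 1) (fun=> F) (fun=> 1) (fun=> F).
rewrite big_pred0; last by case.
rewrite sum_unit mul1r; apply => // x xab.
rewrite big_pred0; last by case.
by rewrite sum_unit mul1r F0.
Qed.

End Functionals.

(** * Maurey's sampling of [lcomb psi h], level by level *)

Section RestrictedEigenvalue.
Context {R : realType} (N : nat).
Variables (a b K : R) (psi : 'I_N.+1 -> {poly R}) (L : nat).
Hypotheses (K1 : 1 <= K) (L0 : (0 < L)%N).
Hypothesis psiK : forall k x, a <= x <= b -> `|(psi k).[x]| <= K.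

Definition lcomb (h : 'cV[R]_N.+1) : {poly R} := \sum_k h k 0 *: psi k.

Let J := ('I_N.+1 * bool)%type.
Let B : R := 2 ^+ L.+2.

(* The constant [2 ^ 18] makes both the variance bound at level 0 and the
   exponential tail bounds at the higher levels at most [1 / (8192 L)]. *)
Definition lvl_size (i : nat) : nat := (2 ^ 18 * L * 4 ^ (L.+2 - i))%N.

Definition sgn_psi (j : J) : {poly R} := (B * (-1) ^+ j.2) *: psi j.1.

(** [h] does not enter: the polynomials of a given level form a finite family fixed in advance, as a
    union bound requires. *)
Definition sampled n (tau : {ffun 'I_n -> J}) : {poly R} :=
  n%:R^-1 *: \sum_l sgn_psi (tau l).

(** The summand [1 / L] pays for the entropy; [4^i / 4^L], which dominates near the top, yields the
    failure probability. Each has a sum over [i <= L] bounded independently of [L]. *)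
Definition lvl_eps (i : nat) : R := 4096^-1 * (L%:R^-1 + 4 ^+ i / 4 ^+ L).

Variable h : 'cV[R]_N.+1.
Hypothesis hB : \sum_k `|h k 0| <= B.

Let B0 : 0 < B. Proof. by rewrite exprn_gt0. Qed.

(* Maurey's sampling law: pairs (index, sign) whose mean is [h]; the slack
   [B - |h|_1] is spread evenly, with opposite signs cancelling. *)
Definition mass (k : 'I_N.+1) : R :=
  `|h k 0| / B + (1 - (\sum_k `|h k 0|) / B) / N.+1%:R.

Definition pair_mass (j : J) : R := mass j.1 / 2 + (-1) ^+ j.2 * h j.1 0 / (2 * B).

Lemma slack_ge0 : 0 <= (1 - (\sum_k `|h k 0|) / B) / N.+1%:R.
Proof. by rewrite divr_ge0// subr_ge0 ler_pdivrMr// mul1r. Qed.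

Lemma mass_ge0 k : 0 <= mass k.
Proof. by rewrite addr_ge0 ?slack_ge0// divr_ge0// ltW. Qed.

Lemma sum_mass : \sum_k mass k = 1.
Proof.
rewrite big_split /= -mulr_suml sumr_const card_ord -[_ *+ N.+1]mulr_natr divfK.
  by rewrite addrC subrK.
by rewrite pnatr_eq0.
Qed.

Lemma sum_pair (f : J -> R) : \sum_j f j = \sum_k (f (k, true) + f (k, false)).
Proof.
transitivity (\sum_k \sum_s f (k, s)); last by apply: eq_bigr => k _; rewrite big_bool.
by rewrite (pair_bigA _ (fun k s => f (k, s))) /=; apply: eq_bigr => -[].
Qed.

Lemma pair_mass_ge0 j : 0 <= pair_mass j.
Proof.
case: j => k s; rewrite /pair_mass /mass /=; have := slack_ge0.
have : `|(-1) ^+ s * h k 0 / (2 * B)| <= `|h k 0| / B / 2.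
  rewrite -mulrA normrMsign normrM normfV (ger0_norm (ltW (mulr_gt0 (ltr0n R 2) B0))).
  by rewrite invfM mulrCA mulrC.
rewrite ler_norml => /andP[]; set X := _ / (2 * B); set sl := (1 - _) / _.
by move: X sl (`|h k 0| / B) => X sl y; lra.
Qed.

Lemma sum_pair_mass : \sum_j pair_mass j = 1.
Proof.
rewrite sum_pair -sum_mass; apply: eq_bigr => k _.
by rewrite /pair_mass /= expr1 expr0; field; rewrite gt_eqF.
Qed.

Lemma mean_sgn_psi x : \sum_j pair_mass j * (sgn_psi j).[x] = (lcomb h).[x].
Proof.
rewrite sum_pair /lcomb horner_sum; apply: eq_bigr => k _.
rewrite /pair_mass /sgn_psi /= !hornerZ expr1 expr0; field.
by rewrite gt_eqF.
Qed.

(** Kept as an exact mixture of the [psi k ^+ 2] instead of being bounded by [K ^+ 2]: under either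
    law each square will contribute at most 3. *)
Lemma var_sgn_psi x : \sum_j pair_mass j * (sgn_psi j).[x] ^+ 2 =
  B ^+ 2 * \sum_k mass k * (psi k).[x] ^+ 2.
Proof.
rewrite sum_pair mulr_sumr; apply: eq_bigr => k _.
rewrite /pair_mass /sgn_psi /= !hornerZ expr1 expr0; field.
by rewrite gt_eqF.
Qed.

Lemma sgn_psi_le j x : a <= x <= b -> `|(sgn_psi j).[x]| <= K * B.
Proof.
move=> xab; rewrite hornerZ normrM mulrC [`|B * _|]normrM normr_sign mulr1 (ger0_norm (ltW B0)).
by rewrite ler_pM2r// psiK.
Qed.

Lemma lvl_size_gt0 i : (0 < lvl_size i)%N.
Proof. by rewrite /lvl_size (muln_gt0 (_ * _)) (muln_gt0 (2 ^ 18)) L0 !expn_gt0. Qed.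

Lemma lvl_sizeE i : (i <= L)%N -> (lvl_size i)%:R * 4 ^+ i = 2 ^+ 18 * L%:R * B ^+ 2 :> R.
Proof.
move=> iL; rewrite /lvl_size (natrM _ (_ * L)%N) (natrM _ (2 ^ 18)%N) (natrX _ 2 18) natrX.
rewrite -(mulrA _ (4 ^+ _)) -exprD subnK; last by rewrite ltnW// ltnW.
by congr (_ * _); rewrite /B -exprM mulnC exprM; congr (_ ^+ _); ring.
Qed.

Lemma sampled_dev n (tau : {ffun 'I_n -> J}) x : (sampled tau - lcomb h).[x] =
  emp_dev pair_mass (fun j => (sgn_psi j).[x]) tau.
Proof.
by rewrite /emp_dev mean_sgn_psi hornerD hornerN hornerZ horner_sum.
Qed.

(** With [y = 2^L], [expR (2^13 L)] is at least [y^64], whereas the other factors amount to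
    [2^28 L^2 y^2 <= y^28 y^2 y^2], by [L <= y] and [2 <= y]. *)
Lemma exp_lvl_le : 2 ^+ 15 * L%:R * 4 ^+ L * expR (- (2 ^+ 13 * L%:R)) <= (8192 * L%:R)^-1 :> R.
Proof.
have LR : 1 <= L%:R :> R by rewrite ler1n.
have e2 : 2 <= expR 1 :> R by have := expR_ge1Dx (1 : R); lra.
have h1 : 2 ^+ (64 * L) <= expR (2 ^+ 13 * L%:R) :> R.
  apply: (@le_trans _ _ (expR 1 ^+ (64 * L))).
    by rewrite lerXn2r// nnegrE ?expR_ge0.
  rewrite -expRM_natl mulr1 ler_expR natrM ler_wpM2r//; lra.
have h2 : L%:R <= 2 ^+ L :> R by rewrite -natrX ler_nat ltnW// ltn_expl.
have p0 : 1 <= 2 ^+ L :> R by rewrite exprn_ege1// ler1n.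
have p2 : 2 <= 2 ^+ L :> R by rewrite -[leLHS]expr1 ler_eXn2l// ltr1n.
have e64 : 2 ^+ (64 * L) = (2 ^+ L) ^+ 64 :> R by rewrite mulnC exprM.
have e4 : 4 ^+ L = (2 ^+ L) ^+ 2 :> R by rewrite -exprM mulnC exprM; congr (_ ^+ _); ring.
rewrite expRN ler_pdivrMr ?expR_gt0// ler_pdivlMl; last by lra.
apply: le_trans h1; rewrite e64 e4.
have : 2 ^+ 28 <= (2 ^+ L) ^+ 28 :> R by rewrite lerXn2r// nnegrE; lra.
set y := 2 ^+ L in h2 p0 p2 *; move: L%:R LR h2 => l l1 ly h28.
have -> : 8192 * l * (2 ^+ 15 * l * y ^+ 2) = 2 ^+ 28 * (l ^+ 2 * y ^+ 2) by ring.
have -> : y ^+ 64 = y ^+ 28 * (y ^+ 2 * y ^+ 2) * y ^+ 32 by ring.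
have y32 : 1 <= y ^+ 32 by rewrite exprn_ege1.
have ly2 : l ^+ 2 <= y ^+ 2 by rewrite lerXn2r// nnegrE; lra.
have y20 : 0 <= y ^+ 2 by rewrite sqr_ge0.
have A : 2 ^+ 28 * (l ^+ 2 * y ^+ 2) <= y ^+ 28 * (y ^+ 2 * y ^+ 2).
  have l20 := sqr_ge0 l; have ly0 : 0 <= l ^+ 2 * y ^+ 2 by rewrite mulr_ge0.
  apply: ler_pM => //; last by rewrite ler_wpM2r.
apply: (le_trans A); rewrite ler_peMr// mulr_ge0//; last by rewrite mulr_ge0.
by rewrite exprn_ge0//; lra.
Qed.

Lemma tail_factorE (k beta c l f e V : R) : k != 0 -> beta != 0 ->
  8 * c * l / 8 * (k ^+ 2 * f / (k * beta) ^+ 2) * e * (beta ^+ 2 * V) = c * l * f * e * V.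
Proof. by move=> k0 b0; field; rewrite k0 b0. Qed.

(** [lvl_size] is inversely proportional to the squared level, so the parameter [be] of
    [emp_dev_tail] is [2^18 L] at each level [i > 0], and [exp_lvl_le] covers them all. At level 0
    the variance gives [32 / (2^18 L)], which is exactly [1 / (8192 L)]. *)
Lemma sampled_dev_le i x : (i <= L)%N -> a <= x <= b ->
  \sum_tau prod_weight pair_mass tau * dev K i (sampled (n := lvl_size i) tau - lcomb h).[x]
  <= (8192 * L%:R)^-1 * \sum_k mass k * (psi k).[x] ^+ 2.
Proof.
move=> iL xab; under eq_bigr do rewrite sampled_dev.
set V := \sum_k mass k * _.
have V0 : 0 <= V by apply: sumr_ge0 => k _; rewrite mulr_ge0 ?mass_ge0// sqr_ge0.
have LR : 1 <= L%:R :> R by rewrite ler1n.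
have yC j := sgn_psi_le j xab.
have n0 := lvl_size_gt0 i; have nE := lvl_sizeE iL.
have nR : 0 < (lvl_size i)%:R :> R by rewrite ltr0n.
case: i iL n0 nE nR => [|i] iL n0 nE nR /=.
  apply: (le_trans (emp_dev_sqr pair_mass_ge0 sum_pair_mass yC n0)).
  rewrite var_sgn_psi -/V.
  move: nE; rewrite expr0 mulr1 => ->.
  rewrite le_eqVlt; apply/orP; left; apply/eqP; field.
  by rewrite !gt_eqF//; lra.
have K0 : 0 < K by exact: lt_le_trans K1.
have KB0 : 0 < K * B by rewrite mulr_gt0.
have t0 : 0 < lev K i.+1 by rewrite mulr_gt0// exprn_gt0.
have tE : lev K i.+1 ^+ 2 = K ^+ 2 * 4 ^+ i.+1.
  by rewrite /lev exprMn -exprM mulnC exprM; congr (_ * _ ^+ _); ring.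
have := @emp_dev_tail _ _ _ pair_mass (fun j => (sgn_psi j).[x]) (K * B)
  pair_mass_ge0 sum_pair_mass yC n0 (lev K i.+1) (2 ^+ 18 * L%:R) KB0.
rewrite var_sgn_psi -/V => H; apply: (le_trans (H _ _ _)).
- rewrite t0 /lev /=.
  have : 2 ^+ i.+1 <= B by rewrite /B ler_eXn2l ?ltr1n// ltnW// ltnW.
  move=> iB; rewrite mulrCA ler_pM2l//; apply: (le_trans iB).
  by rewrite ler_peMl ?ler1n// ltW.
- by rewrite tE mulrCA nE (exprMn _ K B) mulrCA.
- have -> : 32 = 2 ^+ 5 :> R by ring.
  apply: (@le_trans _ _ (2 ^+ 18)); first by rewrite ler_eXn2l ?ltr1n.
  by rewrite ler_peMr ?exprn_ge0.
- rewrite tE; have -> : 2 ^+ 18 = 8 * 2 ^+ 15 :> R by rewrite (exprD 2 3 15); congr (_ * _); ring.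
  rewrite tail_factorE; [|exact: lt0r_neq0|exact: lt0r_neq0].
  have -> : 8 * 2 ^+ 15 * L%:R / 32 = 2 ^+ 13 * L%:R :> R.
    by rewrite (exprD 2 2 13); move: (2 ^+ 13) => c; field.
  rewrite ler_wpM2r//; apply: le_trans exp_lvl_le.
  rewrite ler_wpM2r ?expR_ge0// ler_wpM2l ?mulr_ge0//.
  by rewrite ler_eXn2l// ltr1n.
Qed.

Variables nu emp : (R -> R) -> R.
Hypotheses (mnu : mean_on a b nu) (memp : mean_on a b emp).
Hypotheses (nu_psi : forall k, nu (fun x => (psi k).[x] ^+ 2) <= 3)
  (emp_psi : forall k, emp (fun x => (psi k).[x] ^+ 2) <= 3).

(** The weighted mean over [tau] of the sum of both functionals is at most [6 / kap], so a single
    [tau] satisfies the bound for the sum, and by nonnegativity for each functional. *)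
Lemma sampled_exists i : (i <= L)%N -> exists tau : {ffun 'I_(lvl_size i) -> J},
  nu (fun x => dev K i (sampled tau - lcomb h).[x]) <= 6 / (8192 * L%:R) /\
  emp (fun x => dev K i (sampled tau - lcomb h).[x]) <= 6 / (8192 * L%:R).
Proof.
move=> iL.
pose D tau x := dev K i (sampled (n := lvl_size i) tau - lcomb h).[x].
have D0 (M : (R -> R) -> R) tau : mean_on a b M -> 0 <= M (D tau).
  by move=> mM; apply: (mean_on_ge0 mM); [exact: bdd_borel_dev|move=> x _; exact: dev_ge0].
have LR : 0 < L%:R :> R by rewrite ltr0n.
set kap : R := 8192 * L%:R.
have c0 : 0 < kap^-1 by rewrite invr_gt0 mulr_gt0 ?ltr0n.
have H (M : (R -> R) -> R) : mean_on a b M -> (forall k, M (fun x => (psi k).[x] ^+ 2) <= 3) ->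
    \sum_tau prod_weight pair_mass tau * M (D tau) <= 3 / kap.
  move=> mM M3.
  apply: (@le_trans _ _ (\sum_k (kap^-1 * mass k) * M (fun x => (psi k).[x] ^+ 2))).
    apply: mM => [tau|k|x xab]; [exact: bdd_borel_dev|exact: bdd_borel_horner_sqr|].
    under [leRHS]eq_bigr do rewrite -mulrA.
    by rewrite -mulr_sumr sampled_dev_le.
  apply: (@le_trans _ _ (\sum_k (kap^-1 * mass k) * 3)).
    by apply: ler_sum => k _; rewrite ler_wpM2l// mulr_ge0 ?mass_ge0// ltW.
  by rewrite -mulr_suml -mulr_sumr sum_mass mulr1 mulrC.
have [tau Ht] : exists tau, nu (D tau) + emp (D tau) <= 6 / kap.
  apply: contrapT => /forallNP Hn.
  have : \sum_tau prod_weight pair_mass tau * (nu (D tau) + emp (D tau)) <= 6 / kap.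
    under eq_bigr do rewrite mulrDr.
    by rewrite big_split /=; have := H _ mnu nu_psi; have := H _ memp emp_psi; lra.
  apply/negP; rewrite -ltNge -[ltLHS]mul1r
    -[X in X * _](sum_prod_weight (lvl_size i) sum_pair_mass) mulr_suml.
  have [tau0 T0] : exists tau0, 0 < prod_weight pair_mass (tau0 : {ffun 'I_(lvl_size i) -> J}).
    apply: contrapT => /forallNP H0.
    have := sum_prod_weight (lvl_size i) sum_pair_mass; rewrite big1.
      by move/eqP; rewrite eq_sym oner_eq0.
    move=> tau _; apply/eqP; rewrite eq_le prod_weight_ge0 ?andbT; last exact: pair_mass_ge0.
    by rewrite leNgt; apply/negP; exact: H0.
  rewrite (bigD1 tau0)//= [ltRHS](bigD1 tau0)//=; apply: ltr_leD.
    by rewrite ltr_pM2l// ltNge; apply/negP; exact: Hn.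
  apply: ler_sum => tau _; apply: ler_wpM2l; first exact/prod_weight_ge0/pair_mass_ge0.
  by apply/ltW; rewrite ltNge; apply/negP; exact: Hn.
by exists tau; have := D0 nu tau mnu; have := D0 emp tau memp; split; rewrite -/(D tau); lra.
Qed.

Lemma sum_lvl_eps : \sum_(i < L.+1) lvl_eps i <= 9 / 4096.
Proof.
have LR : 1 <= L%:R :> R by rewrite ler1n.
rewrite /lvl_eps -mulr_sumr big_split /= sumr_const card_ord -mulr_suml.
have -> : (L%:R^-1 : R) *+ L.+1 = 1 + L%:R^-1.
  by rewrite -[LHS]mulr_natr -natr1; field; rewrite pnatr_eq0 -lt0n.
have H n : \sum_(i < n) (4 : R) ^+ i <= 4 ^+ n.
  elim: n => [|n IH]; first by rewrite big_ord0 expr0.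
  by rewrite big_ord_recr /= exprS; have := exprn_ge0 n (ler0n R 4); lra.
have : (\sum_(i < L.+1) (4 : R) ^+ i) / 4 ^+ L <= 4.
  by rewrite ler_pdivrMr ?exprn_gt0// -exprS.
have : L%:R^-1 <= 1 :> R by rewrite invf_le1; lra.
lra.
Qed.

Hypothesis nu_sampled : forall i (tau : {ffun 'I_(lvl_size i) -> J}), (i <= L)%N ->
  nu (fun x => thr (3 / 2) K i (sampled tau).[x])
  <= 2 * (emp (fun x => thr (3 / 2) K i (sampled tau).[x]) + lvl_eps i).

(** [384 = 16 * 8 * 3]: 16 from [sqr_le_sum_thr2], 8 from three passages that each double, 3 from
    [sum_thr1_le]. The errors of all levels add up to less than [1/2]. *)
Lemma mean_sqr_lcomb_le :
  nu (fun x => (lcomb h).[x] ^+ 2) <= 384 * emp (fun x => (lcomb h).[x] ^+ 2) + 1 / 2.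
Proof.
have K0 : 0 <= K by exact: le_trans K1.
have LR : 1 <= L%:R :> R by rewrite ler1n.
pose U i x := thr 2 K i (lcomb h).[x]; pose V i x := thr 1 K i (lcomb h).[x].
(* [60 = 6 * (2 + 8)]: the deviation under [nu] enters twice, the one under [emp] eight times. *)
have step i : (i <= L)%N -> nu (U i) <= 8 * emp (V i) + 4 * lvl_eps i + 60 / (8192 * L%:R).
  move=> iL; have [tau [tnu temp]] := sampled_exists iL.
  pose W x := thr (3 / 2) K i (sampled tau).[x].
  pose D x := dev K i (sampled tau - lcomb h).[x].
  have h1 : nu (U i) <= 2 * nu W + 2 * nu D.
    apply: (mean_on_le mnu); try exact: bdd_borel_thr; first exact: bdd_borel_dev.
    by move=> x _; rewrite /D hornerD hornerN; apply: thr_dev => //; lra.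
  have h2 : emp W <= 2 * emp (V i) + 2 * emp D.
    apply: (mean_on_le memp); try exact: bdd_borel_thr; first exact: bdd_borel_dev.
    move=> x _; rewrite /D hornerD hornerN -devN opprB.
    by apply: thr_dev => //; lra.
  have := nu_sampled tau iL; rewrite -/W -/D in tnu temp *.
  set q := (8192 * L%:R)^-1 in tnu temp *; lra.
have h1 : nu (fun x => (lcomb h).[x] ^+ 2) <= \sum_(i < L.+1) 16 * nu (U i).
  have := @mnu unit 'I_L.+1 (fun=> 1) (fun=> fun x => (lcomb h).[x] ^+ 2) (fun=> 16) (fun i => U i).
  rewrite sum_unit mul1r; apply.
  - by move=> _; exact: bdd_borel_horner_sqr.
  - by move=> i; exact: bdd_borel_thr.
  - move=> x xab; rewrite sum_unit mul1r -mulr_sumr.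
    apply: sqr_le_sum_thr2 => //; rewrite -/B.
    rewrite /lcomb horner_sum; apply: (le_trans (ler_norm_sum _ _ _)).
    rewrite mulrC; apply: le_trans (ler_wpM2r K0 hB); rewrite mulr_suml.
    apply: ler_sum => k _; rewrite hornerZ normrM ler_wpM2l// psiK//.
have h2 : \sum_(i < L.+1) 1 * emp (V i) <= 3 * emp (fun x => (lcomb h).[x] ^+ 2).
  have := @memp 'I_L.+1 unit (fun=> 1) (fun i => V i) (fun=> 3) (fun=> fun x => (lcomb h).[x] ^+ 2).
  rewrite sum_unit; apply.
  - by move=> i; exact: bdd_borel_thr.
  - by move=> _; exact: bdd_borel_horner_sqr.
  - move=> x xab; rewrite sum_unit.
    by under eq_bigr do rewrite mul1r; exact: sum_thr1_le.
apply: (le_trans h1).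
apply: (@le_trans _ _ (\sum_(i < L.+1) (128 * (1 * emp (V i)) + 64 * lvl_eps i + 16 * (60 / (8192 * L%:R))))).
  apply: ler_sum => i _; have := @step i; rewrite -ltnS ltn_ord => /(_ isT).
  move: (60 / _) => q; lra.
move: h2; rewrite 2!big_split /= -!mulr_sumr sumr_const card_ord => h2.
have := sum_lvl_eps; rewrite /lvl_eps -mulr_sumr.
set A := \sum_(i < L.+1) (_ + _); set S := \sum_(i < L.+1) emp _ in h2 *.
have -> : 16 * (60 * ((8192 * L%:R)^-1 *+ L.+1)) = 960 / 8192 * (1 + L%:R^-1) :> R.
  by rewrite -[_ *+ L.+1]mulr_natr -natr1; field; rewrite pnatr_eq0 -lt0n.
have : L%:R^-1 <= 1 :> R by rewrite invf_le1; lra.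
move: h2; move: (L%:R^-1) A S (emp _) => li A S e; lra.
Qed.

End RestrictedEigenvalue.

(** * The restricted eigenvalue bound: probability *)

Section IidSample.
Context d (T : measurableType d) (R : realType) (P : probability T R).
Variables (a b : R) (nu : R -> R) (m : nat) (X : 'I_m -> {RV P >-> R}).
Hypotheses (nuP : is_prob_density a b nu) (iidX : iid_sample a b nu X).

Let Xab j w : a <= X j w <= b.
Proof. by case: iidX. Qed.

Lemma expectation_density (F : R -> R) j : measurable_fun setT F -> (forall x, 0 <= F x) ->
  (\int[P]_w (F (X j w))%:E = \int[@lebesgue_measure R]_(x in `[a, b]) (nu x * F x)%:E)%E.
Proof.
move=> mF F0; case: nuP => mnu nu0 _; case: iidX => _ densX _.
have := @integral_weighted_pushforward _ _ _ (@lebesgue_measure R) `[a, b]%classic (measurable_itv _)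
  nu id (distribution P (X j)) mnu.
move=> /(_ (fun x xab => nu0 x xab) (@measurable_id _ _ setT)) ->//.
  by rewrite ge0_integral_distribution//; exact/measurable_EFinP.
move=> B mB; apply/esym; apply: (etrans (densX j B mB)); apply/esym.
rewrite integral_mkcondl; apply: eq_integral => x _.
by rewrite indicE patchE; case: ifP => _; rewrite ?mulr1// mulr0.
Qed.

Lemma expectation_iid (F : R -> R) j j' : measurable_fun setT F -> (forall x, 0 <= F x) ->
  \int[P]_w F (X j w) = \int[P]_w F (X j' w).
Proof. by move=> mF F0; rewrite /Rintegral !expectation_density. Qed.

Lemma integrable_bdd_borel (F : R -> R) j : bdd_borel a b F ->
  P.-integrable setT (EFin \o (fun w => F (X j w))).
Proof.
move=> [mF [M FM]]; apply: (@bounded_integrable _ _ _ _ _ M); first exact: measurableT_comp.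
by move=> w; apply: FM; exact: Xab.
Qed.

Definition sample_mean (j : 'I_m) (F : R -> R) : R := \int[P]_w F (X j w).

Definition emp_mean (w : T) (F : R -> R) : R := m%:R^-1 * \sum_j F (X j w).

Lemma sample_mean_sum (I : finType) (c : I -> R) (F : I -> R -> R) j :
  (forall i, bdd_borel a b (F i)) ->
  \sum_i c i * sample_mean j (F i) = \int[P]_w (\sum_i c i * F i (X j w)) /\
  P.-integrable setT (EFin \o (fun w => \sum_i c i * F i (X j w))).
Proof.
move=> bF; elim: (index_enum I) => [|i s [IH1 IH2]].
  under [X in P.-integrable _ (EFin \o X)]eq_fun do rewrite big_nil.
  rewrite big_nil; under eq_Rintegral do rewrite big_nil.
  by rewrite Rintegral_cst// mul0r; split => //; exact: finite_measure_integrable_cst.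
under [X in P.-integrable _ (EFin \o X)]eq_fun do rewrite big_cons.
rewrite big_cons IH1; under [in RHS]eq_Rintegral do rewrite big_cons.
have iF := integrable_bdd_borel j (bF i).
have icF : P.-integrable setT (EFin \o (fun w => c i * F i (X j w))).
  exact: (integrableZl measurableT (c i) iF).
split; first by rewrite RintegralD// RintegralZl.
exact: (integrableD measurableT icF IH2).
Qed.

Lemma mean_on_sample_mean j : mean_on a b (sample_mean j).
Proof.
move=> I J c F e G bF bG FG.
have [-> iF] := sample_mean_sum c j bF; have [-> iG] := sample_mean_sum e j bG.
by apply: le_Rintegral => // w _; apply: FG; exact: Xab.
Qed.

Lemma mean_on_emp_mean w : mean_on a b (emp_mean w).
Proof.
move=> I J c F e G _ _ FG.
have E (I' : finType) (c' : I' -> R) (F' : I' -> R -> R) :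
    \sum_i c' i * emp_mean w (F' i) = m%:R^-1 * \sum_j \sum_i c' i * F' i (X j w).
  rewrite exchange_big mulr_sumr; apply: eq_bigr => i _.
  by rewrite mulrCA mulr_sumr.
rewrite !E ler_wpM2l ?invr_ge0//; apply: ler_sum => j _; apply: FG; exact: Xab.
Qed.

Variable j0 : 'I_m.

Let m0 : 0 < m%:R :> R.
Proof. by rewrite ltr0n (leq_trans _ (ltn_ord j0)). Qed.

(** On [[0, 1]], [exp (- y) <= 1 - y / 2], so the mean of [expR (e / (2 t) - H / t)] is at most
    [expR z * (1 - z) <= 1] with [z = e / (2 t)]. Accepting the factor 2 makes the exponent linear
    in [eps] instead of quadratic. *)
Lemma lower_deviation (H : R -> R) (t eps : R) : measurable_fun setT H ->
  (forall x, 0 <= H x <= t) -> 0 < t ->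
  with_prob_ge P (1 - expR (- (m%:R * eps / t)))
    (fun w => sample_mean j0 H <= 2 * (emp_mean w H + eps)).
Proof.
move=> mH Ht t0; set e := sample_mean j0 H.
have t0' := lt0r_neq0 t0.
pose u x := e / (2 * t) - H x / t.
have mu : measurable_fun setT u.
  by apply: measurable_funB => //; exact: measurable_funM.
have u_le x : expR (u x) <= expR (e / (2 * t)) * (1 - H x / (2 * t)).
  rewrite expRD ler_wpM2l ?expR_ge0//.
  set y := H x / t; have [y0 y1] : 0 <= y /\ y <= 1.
    by case/andP: (Ht x) => h0 h1; rewrite divr_ge0 ?(ltW t0)// ler_pdivrMr// mul1r.
  have -> : H x / (2 * t) = y / 2 by rewrite /y; field.
  have h1 := expR_ge1Dx y; have h2 := expR_gt0 y.
  rewrite expRN -(ler_pM2r h2) mulVf ?gt_eqF//.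
  have : (1 - y / 2) * (1 + y) <= (1 - y / 2) * expR y by rewrite ler_wpM2l//; lra.
  nra.
have bH : bdd_borel a b H.
  by split => //; exists t => x _; case/andP: (Ht x) => h0 h1; rewrite ger0_norm.
have bu : bdd_borel a b (expR \o u).
  split; first exact: measurableT_comp.
  exists (expR (e / (2 * t))) => x _ /=; rewrite ger0_norm ?expR_ge0// ler_expR /u.
  by rewrite gerBl divr_ge0 ?(ltW t0)//; case/andP: (Ht x).
have b1 : bdd_borel a b (fun=> 1) by split => //; exists 1 => x _; rewrite normr1.
have m1 : sample_mean j0 (fun=> 1) = 1.
  by rewrite /sample_mean Rintegral_cst// mul1r; exact: (congr1 fine (probability_setT P)).
case: (iidX) => _ _ indX.
have := @exp_moment_tail _ _ _ P m X indX u (e / (2 * t)) (m%:R * eps / t) mu.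
move=> H'; apply: with_prob_ge_le (H' _ _) => //.
- move=> w; rewrite /u sumrB sumr_const card_ord -mulr_suml.
  have -> : e / (2 * t) *+ m - (\sum_(i < m) H (X i w)) / t
    = (m%:R * e / 2 - \sum_(i < m) H (X i w)) / t.
    by rewrite -mulr_natl; field.
  rewrite ltr_pM2r ?invr_gt0// => h; rewrite /emp_mean.
  have -> : 2 * (m%:R^-1 * \sum_(j < m) H (X j w) + eps) =
    2 * (\sum_(j < m) H (X j w) + m%:R * eps) / m%:R by field; rewrite gt_eqF.
  by rewrite ler_pdivlMr// ltW//; lra.
- move=> j w; rewrite /u gerBl divr_ge0 ?(ltW t0)//; by case/andP: (Ht (X j w)).
- move=> j; rewrite (@expectation_iid (expR \o u) j j0)//;
    [|exact: measurableT_comp|by move=> x; exact: expR_ge0].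
  set q := expR (e / (2 * t)).
  apply: (@le_trans _ _ (q * sample_mean j0 (fun=> 1) + - (q / (2 * t)) * e)).
    apply: (mean_on_le (@mean_on_sample_mean j0)) => // x _ /=.
    by apply: (le_trans (u_le x)); rewrite -/q mulr1; lra.
  rewrite m1; have -> : q * 1 + - (q / (2 * t)) * e = q * (1 - e / (2 * t)) by field.
  have h := expR_ge1Dx (- (e / (2 * t))); rewrite expRN in h.
  by rewrite mulrC -ler_pdivlMr ?expR_gt0// mul1r.
Qed.

(** Here [exp y <= 1 + 2 y] on [[0, 1/2]] bounds the exponential moment by
    [exp (- 1 / t) (1 + 1 / t) <= 1]. The 3 is the centering 2 plus a tail of 1. *)
Lemma upper_deviation (H : R -> R) (t : R) : measurable_fun setT H ->
  (forall x, 0 <= H x) -> (forall x, a <= x <= b -> H x <= t) -> 0 < t ->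
  sample_mean j0 H <= 1 ->
  with_prob_ge P (1 - expR (- (m%:R / (2 * t)))) (fun w => emp_mean w H <= 3).
Proof.
move=> mH H0 Ht t0; set e := sample_mean j0 H => e1.
have t0' := lt0r_neq0 t0.
pose u x := H x / (2 * t) - t^-1.
have mu : measurable_fun setT u.
  by apply: measurable_funB => //; exact: measurable_funM.
have u_le x : a <= x <= b -> expR (u x) <= expR (- t^-1) * (1 + H x / t).
  move=> /Ht xt; rewrite expRD mulrC ler_wpM2l ?expR_ge0//.
  set y := H x / (2 * t); have [y0 y1] : 0 <= y /\ y <= 2^-1.
    rewrite divr_ge0 ?mulr_ge0 ?(ltW t0)//; split => //.
    by rewrite ler_pdivrMr ?mulr_gt0// mulrA mulVf// mul1r.
  have -> : H x / t = 2 * y by rewrite /y; field.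
  by have := expR_le_quad y1; nra.
have bH : bdd_borel a b H.
  by split => //; exists t => x /Ht h; rewrite ger0_norm.
have bu : bdd_borel a b (expR \o u).
  split; first exact: measurableT_comp.
  exists (expR (t / (2 * t))) => x /Ht xt /=; rewrite ger0_norm ?expR_ge0// ler_expR /u.
  rewrite lerBlDr; apply: (@le_trans _ _ (t / (2 * t))).
    by rewrite ler_pM2r ?invr_gt0 ?mulr_gt0.
  by rewrite lerDl invr_ge0 ltW.
have b1 : bdd_borel a b (fun=> 1) by split => //; exists 1 => x _; rewrite normr1.
have m1 : sample_mean j0 (fun=> 1) = 1.
  by rewrite /sample_mean Rintegral_cst// mul1r; exact: (congr1 fine (probability_setT P)).
case: (iidX) => _ _ indX.
have := @exp_moment_tail _ _ _ P m X indX u (t / (2 * t)) (m%:R / (2 * t)) mu.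
move=> H'; apply: with_prob_ge_le (H' _ _) => //.
- move=> w; rewrite /u sumrB sumr_const card_ord -mulr_suml.
  have -> : (\sum_(i < m) H (X i w)) / (2 * t) - t^-1 *+ m
    = (\sum_(i < m) H (X i w) - 2 * m%:R) / (2 * t).
    by rewrite -mulr_natl; field.
  rewrite ltr_pM2r ?invr_gt0 ?mulr_gt0// => h; rewrite /emp_mean.
  by rewrite mulrC ler_pdivrMr// ltW//; lra.
- move=> j w; rewrite /u lerBlDr; apply: (@le_trans _ _ (t / (2 * t))).
    by rewrite ler_pM2r ?invr_gt0 ?mulr_gt0// Ht.
  by rewrite lerDl invr_ge0 ltW.
- move=> j; rewrite (@expectation_iid (expR \o u) j j0)//;
    [|exact: measurableT_comp|by move=> x; exact: expR_ge0].
  set q := expR (- t^-1).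
  apply: (@le_trans _ _ (q * sample_mean j0 (fun=> 1) + (q / t) * e)).
    apply: (mean_on_le (@mean_on_sample_mean j0)) => // x xab /=.
    by apply: (le_trans (u_le x xab)); rewrite -/q mulr1; lra.
  rewrite m1; have -> : q * 1 + (q / t) * e = q * (1 + e / t) by field.
  have h := expR_ge1Dx (t^-1).
  rewrite /q expRN mulrC ler_pdivrMr ?expR_gt0// mul1r; apply: le_trans h.
  by rewrite lerD2l ler_pdivrMr// mulVf.
Qed.

Variables (N : nat) (K : R) (psi : 'I_N.+1 -> {poly R}).
Hypothesis orth : orthonormal_wrt a b nu psi.
Hypothesis psiK : forall k x, a <= x <= b -> `|(psi k).[x]| <= K.

Lemma sample_mean_lcomb_sqr (h : 'cV[R]_N.+1) :
  sample_mean j0 (fun x => (lcomb psi h).[x] ^+ 2) = \sum_k h k 0 ^+ 2.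
Proof.
rewrite /sample_mean /Rintegral.
rewrite (@expectation_density (fun x => (lcomb psi h).[x] ^+ 2)); last 2 first.
- by case: (bdd_borel_horner_sqr a b (lcomb psi h)).
- by move=> x; exact: sqr_ge0.
pose I2 := ('I_N.+1 * 'I_N.+1)%type.
pose G (p : I2) x := (psi p.1).[x] * (psi p.2).[x] * nu x.
case: nuP => mnu nu0 nu1.
have inu : (@lebesgue_measure R).-integrable `[a, b] (EFin \o nu).
  apply/integrableP; split; first exact/measurable_EFinP.
  under eq_integral => x /[!inE] xab do rewrite gee0_abs ?lee_fin ?nu0//.
  by rewrite nu1 ltry.
have iG p : (@lebesgue_measure R).-integrable `[a, b] (EFin \o G p).
  have := @integrableMr _ _ _ (@lebesgue_measure R) `[a, b]%classic (measurable_itv _)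
    (fun x => (psi p.1).[x] * (psi p.2).[x]) (EFin \o nu); apply => //.
    by apply: measurable_funTS; apply: measurable_funM; exact: measurable_horner.
  exists (K * K); split; first exact: num_real.
  move=> M KM x /= xab; apply/ltW; apply: le_lt_trans KM.
  by rewrite normrM ler_pM// psiK// -in_itv.
transitivity (fine (\sum_(p : I2) (h p.1 0 * h p.2 0)%:E *
    \int[@lebesgue_measure R]_(x in `[a, b]) (G p x)%:E)%E).
  congr fine; under eq_integral.
    move=> x _.
    have -> : (nu x * (lcomb psi h).[x] ^+ 2)%:E =
        (\sum_(p : I2) ((h p.1 0 * h p.2 0) * G p x)%:E)%E.
      rewrite sumEFin; congr EFin.
      rewrite -(pair_bigA _ (fun i j => h i 0 * h j 0 * G (i, j) x)) /= /G /=.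
      rewrite expr2 /lcomb horner_sum mulrC mulr_suml mulr_suml; apply: eq_bigr => i _.
      rewrite mulr_sumr mulr_suml; apply: eq_bigr => j _.
      by rewrite !hornerZ; ring.
    over.
  rewrite integral_sum//; last first.
    move=> p; have := @integrableZl _ _ _ (@lebesgue_measure R) _ (measurable_itv _)
      (h p.1 0 * h p.2 0) _ (iG p).
    exact.
  apply: eq_bigr => p _; under eq_integral do rewrite EFinM.
  have := @integralZl _ _ _ (@lebesgue_measure R) _ (measurable_itv _) _ (iG p).
  exact.
have -> : (\sum_(p : I2) (h p.1 0 * h p.2 0)%:E *
    \int[@lebesgue_measure R]_(x in `[a, b]) (G p x)%:E)%E =
    (\sum_(p : I2) (h p.1 0 * h p.2 0 * (p.1 == p.2)%:R))%:E.
  rewrite -sumEFin; apply: eq_bigr => p _.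
  by rewrite /G orth -EFinM.
rewrite /= -(pair_bigA _ (fun i j => h i 0 * h j 0 * (i == j)%:R)) /=.
apply: eq_bigr => i _; rewrite (bigD1 i)//= eqxx mulr1 big1 ?addr0 ?expr2// => j ji.
by rewrite eq_sym (negPf ji) mulr0.
Qed.

End IidSample.

(** * Number of sampled polynomials against the deviation exponent *)

Section UnionBound.
Context {R : realType}.

(* At one level, the entropy [2 n l] of the family of sampled polynomials is
   absorbed by the deviation exponent. *)
Lemma exponent_bound (c l n f F ell M k eps : R) :
  4 <= c -> 0 < l -> 0 < f -> f <= F -> 1 <= ell -> 0 < k ->
  n * f = c / 2 * ell * F -> eps = (ell^-1 + f / F) / 4096 ->
  2 * c * 4096 * 16 * k * F * ell ^+ 3 * l <= M ->
  n * (2 * l) - M * eps / (16 * k * f) <= - (ell ^+ 3 + ell + 2) * l.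
Proof.
move=> c4 l0 f0 fF ell1 k0 nf epsE HM.
have F0 : 0 < F by apply: lt_le_trans fF.
have e0 : 0 < ell by apply: lt_le_trans ell1.
have c0 : 0 <= c by apply: le_trans c4; exact: ler0n.
have nE : n = c / 2 * ell * (F / f).
  by rewrite mulrA -nf mulfK// gt_eqF.
set g := F / f in nE; have g1 : 1 <= g by rewrite ler_pdivlMr// mul1r.
(* The part [1 / ell] of [eps] produces [g ell^2], enough for the entropy [n * 2 = c g ell]; the
   part [f / F] produces [ell^3], the exponent of the failure probability. *)
have h1 : 2 * c * l * (g * ell ^+ 2 + ell ^+ 3) <= M * eps / (16 * k * f).
  have -> : 2 * c * l * (g * ell ^+ 2 + ell ^+ 3) =
      (2 * c * 4096 * 16 * k * F * ell ^+ 3 * l) * (eps / (16 * k * f)).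
    by rewrite epsE /g; field; rewrite !gt_eqF.
  rewrite -[leRHS]mulrA; apply: ler_wpM2r HM; apply: divr_ge0; last by rewrite !mulr_ge0 ?ltW.
  rewrite epsE; apply: divr_ge0; last exact: ler0n.
  by rewrite addr_ge0 ?invr_ge0 ?divr_ge0 ?ltW.
suff : n * 2 + ell ^+ 3 + ell + 2 <= 2 * c * (g * ell ^+ 2 + ell ^+ 3).
  move=> h2; have := ler_wpM2r (ltW l0) h2; clear - h1; lra.
rewrite nE.
have e2 : ell <= ell ^+ 2 by rewrite expr2 ler_peMr// ltW.
have e3 : ell ^+ 2 <= ell ^+ 3 by rewrite (exprS _ 2) ler_peMl// ?sqr_ge0.
have ge : 0 <= c * g * (ell ^+ 2 - ell).
  by rewrite mulr_ge0 ?subr_ge0// mulr_ge0// (le_trans ler01).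
have ce : 0 <= (c - 4) * ell ^+ 3 by rewrite mulr_ge0 ?subr_ge0// exprn_ge0 ?ltW.
have cg : 0 <= c * g * ell ^+ 2 by rewrite mulr_ge0 ?sqr_ge0// mulr_ge0// (le_trans ler01).
clear - c4 ell1 e2 e3 ge ce cg.
move: (ell ^+ 2) (ell ^+ 3) e2 e3 ge ce cg => x y; lra.
Qed.

Lemma expR_lnN n : expR (ln n.+1%:R) = n.+1%:R :> R.
Proof. by rewrite lnK// posrE ltr0n. Qed.

Lemma ln_natS_gt0 n : (0 < n)%N -> 0 < ln n.+1%:R :> R.
Proof. by move=> n0; rewrite ln_gt0// ltr1n. Qed.

(** Each draw has [2 (N + 1)] outcomes, at most [(N + 1)^2] because [N >= 1]. *)
Lemma card_signed_seq N n : (0 < N)%N -> #|{: {ffun 'I_n -> 'I_N.+1 * bool}}|%:R <=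
  expR (n%:R * (2 * ln N.+1%:R)) :> R.
Proof.
move=> N0.
rewrite card_ffun card_prod card_bool !card_ord natrX expRM_natl.
rewrite lerXn2r ?nnegrE ?expR_ge0// (expRM_natl 2) expR_lnN expr2 natrM.
by rewrite ler_wpM2l// ler_nat.
Qed.

(** There are [L + 2] groups of events: the [L + 1] levels and the bounds on the [psi k]. The
    surplus [L + 2] in the exponent pays for their number, as
    [(N + 1)^(L + 2) >= 2^(L + 2) > L + 2]. *)
Lemma union_bound_total (L N : nat) (S : R) : (0 < N)%N ->
  S <= (L.+2)%:R * expR (- (L%:R ^+ 3 + L%:R + 2) * ln N.+1%:R) ->
  S <= N.+1%:R `^ (- L%:R ^+ 3).
Proof.
move=> N0 h; apply: (le_trans h).
rewrite /powR pnatr_eq0 /=.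
have -> : - (L%:R ^+ 3 + L%:R + 2) * ln N.+1%:R = - L%:R ^+ 3 * ln N.+1%:R - L.+2%:R * ln N.+1%:R :> R.
  by rewrite -[L.+2%:R]natr1 -[L.+1%:R]natr1; ring.
rewrite expRD expRN mulrCA ger_pMr ?expR_gt0// ler_pdivrMr ?expR_gt0// mul1r.
rewrite expRM_natl expR_lnN -natrX ler_nat.
by apply: (leq_trans (ltnW (ltn_expl L.+2 (ltnSn 1)))); rewrite leq_exp2r.
Qed.

End UnionBound.

Section SampledRestrictedEigenvalue.
Context d (T : measurableType d) (R : realType) (P : probability T R).
Variables (a b : R) (nu : R -> R) (m : nat) (X : 'I_m -> {RV P >-> R}).
Hypotheses (nuP : is_prob_density a b nu) (iidX : iid_sample a b nu X).
Variables (N L : nat) (K : R) (psi : 'I_N.+1 -> {poly R}).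
Hypothesis orth : orthonormal_wrt a b nu psi.
Hypothesis psiK : forall k x, a <= x <= b -> `|(psi k).[x]| <= K.
Hypotheses (N0 : (0 < N)%N) (m0 : (0 < m)%N) (L0 : (0 < L)%N) (K1 : 1 <= K).

Let c : R := 2 ^+ 23.
Hypothesis mL : 2 * c * 4096 * 16 * K ^+ 2 * 4 ^+ L * L%:R ^+ 3 * ln N.+1%:R <= m%:R.

Let K0 : 0 < K. Proof. exact: lt_le_trans K1. Qed.
Let K20 : 0 < K ^+ 2. Proof. exact: exprn_gt0. Qed.
Let LR : 1 <= L%:R :> R. Proof. by rewrite ler1n. Qed.
Let l0 : 0 < ln N.+1%:R :> R. Proof. exact: ln_natS_gt0. Qed.
Let c4 : 4 <= c.
Proof.
have -> : 4 = 2 ^+ 2 :> R by ring.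
by rewrite ler_eXn2l ?ltr1n.
Qed.

Lemma restricted_eigenvalue :
  with_prob_ge P (1 - N.+1%:R `^ (- L%:R ^+ 3))
   (fun w => forall h : 'cV[R]_N.+1,
     \sum_k `|h k 0| <= 2 ^+ L.+2 * Num.sqrt (\sum_k h k 0 ^+ 2) ->
     \sum_k h k 0 ^+ 2 <= 768 * emp_mean X w (fun x => (lcomb psi h).[x] ^+ 2)).
Proof.
pose j0 := Ordinal m0.
pose H i (tau : {ffun 'I_(lvl_size L i) -> 'I_N.+1 * bool}) x :=
  thr (3 / 2) K i (sampled psi L tau).[x].
have nu1 k : sample_mean X j0 (fun x => (psi k).[x] ^+ 2) = 1.
  have := sample_mean_lcomb_sqr nuP iidX j0 orth psiK (delta_mx k 0).
  rewrite (bigD1 k)//= big1 => [|i ik]; last by rewrite mxE (negPf ik) expr0n.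
  rewrite mxE !eqxx expr1n addr0 => <-.
  have -> // : lcomb psi (delta_mx k 0) = psi k.
  rewrite /lcomb (bigD1 k)//= big1 => [|i ik]; last by rewrite mxE (negPf ik) scale0r.
  by rewrite mxE !eqxx scale1r addr0.
have ev1 : with_prob_ge P (1 - \sum_(k < N.+1) expR (- (m%:R / (2 * K ^+ 2))))
    (fun w => forall k, emp_mean X w (fun x => (psi k).[x] ^+ 2) <= 3).
  apply: with_prob_ge_all => k.
  apply: (upper_deviation nuP iidX (j0 := j0)) => //.
  - by case: (bdd_borel_horner_sqr a b (psi k)).
  - by move=> x; exact: sqr_ge0.
  - move=> x xab; rewrite -[_ ^+ 2]real_normK ?num_real// lerXn2r ?nnegrE ?psiK//.
    exact: ltW.
  - by rewrite nu1.
have ev2 : with_prob_ge P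
    (1 - \sum_(i < L.+1) \sum_(tau : {ffun 'I_(lvl_size L i) -> 'I_N.+1 * bool})
       expR (- (m%:R * lvl_eps L i / (16 * K ^+ 2 * 4 ^+ i))))
    (fun w => forall (i : 'I_L.+1) (tau : {ffun 'I_(lvl_size L i) -> 'I_N.+1 * bool}),
       sample_mean X j0 (H i tau) <= 2 * (emp_mean X w (H i tau) + lvl_eps L i)).
  apply: with_prob_ge_all => i; apply: with_prob_ge_all => tau.
  apply: (lower_deviation nuP iidX) => //.
  - by case: (bdd_borel_thr a b (3 / 2) K i (sampled psi L tau)).
  - by move=> x; rewrite thr_ge0 thr_le.
  - by rewrite mulr_gt0 ?exprn_gt0 ?mulr_gt0.
have := with_prob_geI ev1 ev2; apply: with_prob_ge_le.
  rewrite lerD2l lerN2; apply: (@union_bound_total R L) => //.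
  rewrite -[L.+2%:R]natr1 [leRHS]mulrDl [1 * _]mul1r [leLHS]addrC; apply: lerD.
    set e := expR _; have -> : L.+1%:R * e = \sum_(i < L.+1) e by rewrite sumr_const card_ord mulr_natl.
    apply: ler_sum => i _.
    have iL : (i <= L)%N by rewrite -ltnS.
    rewrite sumr_const -[leLHS]mulr_natl.
    apply: (le_trans (ler_wpM2r (expR_ge0 _) (card_signed_seq _ N0))).
    rewrite -expRD ler_expR.
    apply: (@exponent_bound R c _ _ (4 ^+ i) (4 ^+ L) _ m%:R) => //.
    - by rewrite ler_eXn2l ?ltr1n.
    - rewrite lvl_sizeE// /c -[2 ^+ 23]/(2 ^+ (18 + 5)) exprD.
      have -> : (2 ^+ L.+2) ^+ 2 = 2 ^+ 4 * 4 ^+ L :> R.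
        rewrite -exprM -[L.+2]addn2 mulnDl exprD mulrC; congr (_ * _).
        by rewrite mulnC exprM; congr (_ ^+ _); ring.
      by move: (2 ^+ 18) (4 ^+ L) => x y; field.
    - by rewrite /lvl_eps mulrC.
  (* The [N + 1] events on the [psi k] add one [ln N.+1] to the exponent, and
     [L^3 + L + 3 <= 5 L^3]. *)
  rewrite sumr_const card_ord -[leLHS]mulr_natl -[X in X * _](expR_lnN N) -expRD ler_expR.
  suff : 2 * K ^+ 2 * (5 * L%:R ^+ 3 * ln N.+1%:R) <= m%:R.
    rewrite mulrC -ler_pdivlMr ?mulr_gt0// => h.
    have e2 : L%:R <= L%:R ^+ 2 :> R by rewrite expr2 ler_peMr// (le_trans ler01).
    have e3 : L%:R ^+ 2 <= L%:R ^+ 3 :> R by rewrite (exprS _ 2) ler_peMl// sqr_ge0.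
    have : 0 <= (5 * L%:R ^+ 3 - (L%:R ^+ 3 + L%:R + 3)) * ln N.+1%:R :> R.
      by rewrite mulr_ge0 ?(ltW l0)//; have := LR; lra.
    move: h; move: (L%:R) (L%:R ^+ 3) (ln _) (m%:R / _) => z y l q; lra.
  apply: le_trans mL.
  have -> : 2 * c * 4096 * 16 * K ^+ 2 * 4 ^+ L * L%:R ^+ 3 * ln N.+1%:R =
     2 * K ^+ 2 * ((c * (4096 * 16) * 4 ^+ L) * (L%:R ^+ 3 * ln N.+1%:R)).
    by move: (c) (4 ^+ L) (L%:R) => x y z; ring.
  rewrite ler_pM2l ?mulr_gt0// -[5 * _ * _]mulrA ler_pM2r; last first.
    by rewrite mulr_gt0// exprn_gt0// (lt_le_trans ltr01).
  have L41 : 1 <= 4 ^+ L :> R by rewrite exprn_ege1// ler1n.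
  have c5 : 5 <= c * (4096 * 16).
    by have := c4; move: (c) => x ?; lra.
  apply: (le_trans c5); apply: ler_peMr L41; apply: le_trans c5; exact: ler0n.
move=> w [ev1w ev2w] h hB.
set S := \sum_k h k 0 ^+ 2.
have S0 : 0 <= S by apply: sumr_ge0 => k _; exact: sqr_ge0.
have emp0 (p : {poly R}) : 0 <= emp_mean X w (fun x => p.[x] ^+ 2).
  by rewrite mulr_ge0 ?invr_ge0// sumr_ge0// => j _; exact: sqr_ge0.
have [->|Sn0] := eqVneq S 0; first by apply: mulr_ge0; [exact: ler0n|exact: emp0].
have Sp : 0 < S by rewrite lt0r Sn0.
have q0 : 0 < Num.sqrt S by rewrite sqrtr_gt0.
(* The claim is homogeneous. At norm 1 the additive [1/2] of [mean_sqr_lcomb_le] is half of the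
   left-hand side, hence 768, twice 384. *)
pose g := (Num.sqrt S)^-1 *: h.
have gE x : (lcomb psi g).[x] = (Num.sqrt S)^-1 * (lcomb psi h).[x].
  rewrite /lcomb !horner_sum mulr_sumr; apply: eq_bigr => k _.
  by rewrite !hornerZ mxE mulrA.
have gB : \sum_k `|g k 0| <= 2 ^+ L.+2.
  under eq_bigr do rewrite mxE normrM normfV (ger0_norm (ltW q0)).
  by rewrite -mulr_sumr mulrC ler_pdivrMr.
have gS : \sum_k g k 0 ^+ 2 = 1.
  under eq_bigr do rewrite mxE exprMn exprVn sqr_sqrtr//.
  by rewrite -mulr_sumr -/S mulVf.
have e1 k : sample_mean X j0 (fun x => (psi k).[x] ^+ 2) <= 3 by rewrite nu1 ler1n.
have := mean_sqr_lcomb_le K1 L0 psiK gB (mean_on_sample_mean iidX j0) (mean_on_emp_mean iidX w)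
  e1 ev1w.
rewrite (sample_mean_lcomb_sqr nuP iidX j0 orth psiK) gS => HH.
have {}HH : 1 <= 384 * emp_mean X w (fun x => (lcomb psi g).[x] ^+ 2) + 1 / 2.
  by apply: HH => i tau iL; exact: (ev2w (Ordinal (iL : (i < L.+1)%N)) tau).
have eE : emp_mean X w (fun x => (lcomb psi g).[x] ^+ 2) =
    S^-1 * emp_mean X w (fun x => (lcomb psi h).[x] ^+ 2).
  rewrite /emp_mean [RHS]mulrCA; congr (_ * _); rewrite mulr_sumr; apply: eq_bigr => j _.
  by rewrite gE exprMn exprVn sqr_sqrtr.
rewrite eE in HH; rewrite -[leLHS]mulr1 -ler_pdivlMl//.
move: HH; set e := emp_mean _ _ _; rewrite mulrCA; move: (S^-1 * e) => y; lra.
Qed.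

End SampledRestrictedEigenvalue.

(** * Jackson's theorem *)

Section Jackson.
Context {R : realType}.
Implicit Types (n k : nat) (c : nat -> R) (x t th : R).

Fixpoint cheb n : {poly R} :=
  match n with
  | 0 => 1
  | n'.+1 => match n' with 0 => 'X | n''.+1 => 2 *: ('X * cheb n') - cheb n'' end
  end.

Lemma chebSS n : cheb n.+2 = 2 *: ('X * cheb n.+1) - cheb n.
Proof. by []. Qed.

Lemma cheb_cos n th : (cheb n).[cos th] = cos (n%:R * th).
Proof.
suff : (cheb n).[cos th] = cos (n%:R * th) /\ (cheb n.+1).[cos th] = cos (n.+1%:R * th) by case.
elim: n => [|n [IH1 IH2]]; first by rewrite /= hornerC hornerX mul0r cos0 mul1r.
split => //; rewrite chebSS hornerD hornerN hornerZ hornerM hornerX IH1 IH2.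
have -> : n.+2%:R * th = n.+1%:R * th + th by rewrite -[n.+2%:R]natr1; ring.
have -> : n%:R * th = n.+1%:R * th - th by rewrite -[n.+1%:R]natr1; ring.
by rewrite cosB cosD; ring.
Qed.

Lemma size_cheb n : (size (cheb n) <= n.+1)%N.
Proof.
suff : (size (cheb n) <= n.+1)%N /\ (size (cheb n.+1) <= n.+2)%N by case.
elim: n => [|n [IH1 IH2]]; first by rewrite size_poly1 /= size_polyX.
split => //; rewrite chebSS (leq_trans (size_polyD _ _))// geq_max size_polyN.
rewrite (leq_trans IH1) ?andbT; last by rewrite ltnW// ltnW.
apply: (leq_trans (size_scale_leq _ _)).
by rewrite mulrC (leq_trans (size_polyMleq _ _))// size_polyX addn2 /= ltnS.
Qed.

(* The squared modulus of the exponential sum with coefficients [c]. *)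
Definition trig_sqr n c x : R :=
  (\sum_(k < n) c k * cos (k%:R * x)) ^+ 2 + (\sum_(k < n) c k * sin (k%:R * x)) ^+ 2.

Lemma trig_sqr_ge0 n c x : 0 <= trig_sqr n c x.
Proof. by rewrite addr_ge0// sqr_ge0. Qed.

Lemma trig_sqrE n c x : trig_sqr n c x =
  \sum_(k < n) \sum_(l < n) c k * c l * cos (k%:R * x - l%:R * x).
Proof.
rewrite /trig_sqr !expr2 !mulr_suml -big_split; apply: eq_bigr => k _ /=.
rewrite !mulr_sumr -big_split; apply: eq_bigr => l _ /=.
by rewrite cosB; ring.
Qed.

Lemma trig_sqrN n c x : trig_sqr n c (- x) = trig_sqr n c x.
Proof.
rewrite !trig_sqrE; apply: eq_bigr => k _; apply: eq_bigr => l _.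
by rewrite -[in RHS]cosN; congr (_ * cos _); ring.
Qed.

Lemma sin_add_period x n : sin (x + n%:R * (2 * pi)) = sin x.
Proof.
elim: n => [|n IH]; first by rewrite mul0r addr0.
by rewrite -natr1 mulrDl mul1r addrA [2 * pi]mulr_natl sinD2pi -[pi *+ 2]mulr_natl IH.
Qed.

(** Multiplied by [2 sin (de / 2)] the sum telescopes over whole periods; [0 < k < n] puts [de / 2]
    strictly between 0 and [pi], so this factor is nonzero. *)
Lemma sum_cos_nodes n k x : (0 < k < n)%N ->
  \sum_(j < n) cos (x + j%:R * (k%:R * (2 * pi / n%:R))) = 0.
Proof.
move=> /andP[k0 kn]; set de := k%:R * _.
have n0 : 0 < n%:R :> R by rewrite ltr0n (leq_ltn_trans _ kn).
have s0 : 0 < sin (de / 2).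
  apply: sin_gt0_pi; have -> : de / 2 = pi * (k%:R / n%:R) by rewrite /de; field; rewrite gt_eqF.
  rewrite mulr_gt0 ?pi_gt0//=; last by rewrite divr_gt0// ltr0n.
  by rewrite gtr_pMr ?pi_gt0// ltr_pdivrMr// mul1r ltr_nat.
have tel q : 2 * sin (de / 2) * \sum_(j < q) cos (x + j%:R * de) =
    sin (x - de / 2 + q%:R * de) - sin (x - de / 2).
  elim: q => [|q IH]; first by rewrite big_ord0 mulr0 mul0r addr0 subrr.
  rewrite big_ord_recr /= mulrDr IH.
  have -> : x - de / 2 + q.+1%:R * de = (x + q%:R * de) + de / 2.
    by rewrite -natr1; field.
  have -> : x - de / 2 + q%:R * de = (x + q%:R * de) - de / 2 by ring.
  set y := x + _; rewrite (sinD y (de / 2)) (sinB y (de / 2)).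
  by move: (sin (x - _)) (cos y) (sin y) => u v w; ring.
have : 2 * sin (de / 2) * \sum_(j < n) cos (x + j%:R * de) = 0.
  rewrite tel; have -> : n%:R * de = k%:R * (2 * pi) by rewrite /de; field; rewrite gt_eqF.
  by rewrite sin_add_period subrr.
by move=> /eqP; rewrite mulf_eq0 mulf_eq0 pnatr_eq0 (gt_eqF s0)/= => /eqP.
Qed.

(** Discrete Parseval: distinct frequencies below [n <= q] never differ by a multiple of [q], so [q]
    equidistant nodes average the squared modulus exactly, for every shift [x]. No convolution
    integral is needed. *)
Lemma sum_trig_sqr_nodes q n c x : (n <= q)%N -> (0 < q)%N ->
  \sum_(j < q) trig_sqr n c (x + j%:R * (2 * pi / q%:R)) = q%:R * \sum_(k < n) c k ^+ 2.
Proof.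
move=> nq q0; under eq_bigr do rewrite trig_sqrE.
rewrite exchange_big mulr_sumr; apply: eq_bigr => k _.
rewrite exchange_big (bigD1 k)//= [X in _ + X]big1 ?addr0.
  under eq_bigr do rewrite subrr cos0 mulr1.
  by rewrite sumr_const card_ord -[LHS]mulr_natl expr2.
move=> l lk; rewrite -mulr_sumr.
suff -> : \sum_(j < q) cos (k%:R * (x + j%:R * (2 * pi / q%:R)) - l%:R * (x + j%:R * (2 * pi / q%:R))) = 0.
  by rewrite mulr0.
have [lk'|kl|e] := ltngtP l k; last by move: lk; rewrite -val_eqE /= e eqxx.
- rewrite -[RHS](@sum_cos_nodes q (k - l) ((k - l)%:R * x)).
    by apply: eq_bigr => j _; congr cos; rewrite natrB ?(ltnW lk')//; ring.
  by rewrite subn_gt0 lk' (leq_ltn_trans (leq_subr _ _))// (leq_trans (ltn_ord k)).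
- rewrite -[RHS](@sum_cos_nodes q (l - k) ((l - k)%:R * x)).
    by apply: eq_bigr => j _; rewrite -cosN; congr cos; rewrite natrB ?(ltnW kl)//; ring.
  by rewrite subn_gt0 kl (leq_ltn_trans (leq_subr _ _))// (leq_trans (ltn_ord l)).
Qed.

(* [2 (1 - cos x)] is the squared modulus of [1 - e^(ix)], so multiplying by it
   replaces the coefficients by their differences. *)
Lemma trig_sqr_diff n c x : c n = 0 ->
  2 * (1 - cos x) * trig_sqr n c x =
  trig_sqr n.+1 (fun k => c k - (if k is k'.+1 then c k' else 0)) x.
Proof.
move=> cn; rewrite /trig_sqr.
set A := \sum_(k < n) c k * cos _; set B := \sum_(k < n) c k * sin _.
have shift (F : R -> R) : \sum_(k < n.+1) (c k - (if (k : nat) is k'.+1 then c k' else 0)) * F (k%:R * x)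
    = \sum_(k < n) c k * F (k%:R * x) - \sum_(k < n) c k * F (k%:R * x + x).
  under eq_bigr do rewrite mulrBl.
  rewrite sumrB big_ord_recr /= cn mul0r addr0; congr (_ - _).
  rewrite big_ord_recl /= mul0r add0r; apply: eq_bigr => k _ /=.
  by congr (_ * F _); rewrite /bump /= natrD; ring.
rewrite !shift -/A -/B.
have -> : \sum_(k < n) c k * cos (k%:R * x + x) = A * cos x - B * sin x.
  by rewrite !mulr_suml -sumrB; apply: eq_bigr => k _; rewrite cosD; ring.
have -> : \sum_(k < n) c k * sin (k%:R * x + x) = B * cos x + A * sin x.
  by rewrite !mulr_suml -big_split; apply: eq_bigr => k _ /=; rewrite sinD; ring.
have := cos2Dsin2 x; move: (cos x) (sin x) A B => u v A B h.
have -> : 2 * (1 - u) = (1 - u) ^+ 2 + v ^+ 2 by lra.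
ring.
Qed.

Definition node q j : R := j%:R * (2 * pi / q%:R).

(** Convolution of [g (cos t)] with the kernel [trig_sqr n c], discretized at the nodes and
    rewritten in powers of [cos th]. Truncated subtraction makes [(k - l) + (l - k)] the distance of
    [k] and [l]. *)
Definition jackson_poly n q c (g : R -> R) : {poly R} :=
  (q%:R * \sum_(k < n) c k ^+ 2)^-1 *: \sum_(j < q) \sum_(k < n) \sum_(l < n)
    (g (cos (node q j)) * (c k * c l * cos (k%:R * node q j - l%:R * node q j))) *:
    cheb ((k - l) + (l - k)).

Lemma size_jackson_poly n q c g : (0 < n)%N -> (size (jackson_poly n q c g) <= n)%N.
Proof.
move=> n0; apply: (leq_trans (size_scale_leq _ _)).
apply: (leq_trans (size_sum _ _ _)); apply/bigmax_leqP => j _.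
apply: (leq_trans (size_sum _ _ _)); apply/bigmax_leqP => k _.
apply: (leq_trans (size_sum _ _ _)); apply/bigmax_leqP => l _.
apply: (leq_trans (size_scale_leq _ _)); apply: (leq_trans (size_cheb _)).
have := ltn_ord k; have := ltn_ord l; lia.
Qed.

(** Averaging over [t] and [- t] removes the sine terms in [th], which leaves a polynomial in
    [cos th]. *)
Definition jackson_ker n c th t : R := 2^-1 * (trig_sqr n c (th + t) + trig_sqr n c (th - t)).

Lemma jackson_poly_cos n q c g th : (jackson_poly n q c g).[cos th] =
  (q%:R * \sum_(k < n) c k ^+ 2)^-1 * \sum_(j < q) g (cos (node q j)) * jackson_ker n c th (node q j).
Proof.
rewrite hornerZ horner_sum; congr (_ * _); apply: eq_bigr => j _.
move: (node q j) => t.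
rewrite /jackson_ker !trig_sqrE -big_split mulr_sumr mulr_sumr horner_sum.
apply: eq_bigr => k _ /=; rewrite -big_split !mulr_sumr horner_sum.
apply: eq_bigr => l _ /=; rewrite hornerZ cheb_cos.
have -> : cos ((k - l + (l - k))%N%:R * th) = cos (k%:R * th - l%:R * th).
  have [lk|kl] := leqP l k.
    by rewrite (eqP lk) addn0 natrB//; congr cos; ring.
  have /eqP -> : (k - l == 0)%N by rewrite subn_eq0 ltnW.
  by rewrite add0n natrB ?(ltnW kl)// -cosN; congr cos; ring.
have -> : k%:R * (th + t) - l%:R * (th + t) = (k%:R * th - l%:R * th) + (k%:R * t - l%:R * t) by ring.
have -> : k%:R * (th - t) - l%:R * (th - t) = (k%:R * th - l%:R * th) - (k%:R * t - l%:R * t) by ring.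
by rewrite (cosD (k%:R * th - _)) (cosB (k%:R * th - _)); field.
Qed.

Lemma sum_jackson_ker n q c th : (n <= q)%N -> (0 < q)%N ->
  \sum_(j < q) jackson_ker n c th (node q j) = q%:R * \sum_(k < n) c k ^+ 2.
Proof.
move=> nq q0; rewrite -mulr_sumr big_split /=.
have -> : \sum_(j < q) trig_sqr n c (th - node q j) = \sum_(j < q) trig_sqr n c (- th + node q j).
  by apply: eq_bigr => j _; rewrite -trig_sqrN; congr trig_sqr; ring.
by rewrite !sum_trig_sqr_nodes//; field.
Qed.

(** [2 (1 - cos (th - t))] is the squared chord between two points of the unit circle, and
    [cos th - cos t] is one of its coordinates; replacing [t] by [- t] treats the other summand.
    Then [trig_sqr_diff] absorbs the factor. *)
Lemma sqr_dist_jackson_ker n c th t : c n = 0 ->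
  (cos th - cos t) ^+ 2 * jackson_ker n c th t <=
  jackson_ker n.+1 (fun k => c k - (if k is k'.+1 then c k' else 0)) th t.
Proof.
move=> cn; rewrite /jackson_ker -!trig_sqr_diff//.
have h1 : (cos th - cos t) ^+ 2 <= 2 * (1 - cos (th + t)).
  have := cos2Dsin2 th; have := cos2Dsin2 t; rewrite cosD.
  have := sqr_ge0 (sin th + sin t); nra.
have h2 : (cos th - cos t) ^+ 2 <= 2 * (1 - cos (th - t)).
  have := cos2Dsin2 th; have := cos2Dsin2 t; rewrite cosB.
  have := sqr_ge0 (sin th - sin t); nra.
have := ler_wpM2r (trig_sqr_ge0 n c (th + t)) h1.
have := ler_wpM2r (trig_sqr_ge0 n c (th - t)) h2.
lra.
Qed.

(** The coefficients [1, 2, ..., p + 1, ..., 2, 1] of the square of [1 + z + ... + z^p]: the squared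
    modulus is the Jackson kernel, a squared Fejer kernel up to scale. At [k = 2 p + 1] the value is
    0, as [trig_sqr_diff] requires. *)
Definition triangle p k : R := (minn k.+1 (p.*2.+1 - k))%:R.

Lemma triangle_diff p k : (triangle p k - (if k is k'.+1 then triangle p k' else 0)) ^+ 2 <= 1.
Proof.
have H (u v : nat) : (u <= v.+1)%N -> (v <= u.+1)%N -> (u%:R - v%:R : R) ^+ 2 <= 1.
  rewrite -(ler_nat R) -[(v <= _)%N](ler_nat R) -!natr1; nra.
by case: k => [|k]; [apply: (H _ 0)|apply: H]; rewrite /triangle; lia.
Qed.

Lemma sum_triangle_ge p : p.+1%:R ^+ 3 / 3 <= \sum_(k < p.*2.+1) triangle p k ^+ 2.
Proof.
have pp : (p.+1 <= p.*2.+1)%N by lia.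
have h1 : \sum_(k < p.+1) (k.+1%:R : R) ^+ 2 <= \sum_(k < p.*2.+1) triangle p k ^+ 2.
  rewrite (big_ord_widen _ (fun k => (k.+1%:R : R) ^+ 2) pp) big_mkcond /=.
  apply: ler_sum => k _; case: ifP => kp; last exact: sqr_ge0.
  rewrite lerXn2r ?nnegrE// ler_nat; lia.
apply: le_trans h1; elim: p.+1 => [|q IH]; first by rewrite big_ord0 expr0n /= mul0r.
rewrite big_ord_recr /=; apply: le_trans (lerD IH (lexx _)).
by rewrite -natr1; have := ler0n R q; nra.
Qed.

Lemma jackson_unit p (g : R -> R) (M : R) :
  (forall x y, -1 <= x <= 1 -> -1 <= y <= 1 -> `|g x - g y| <= M * `|x - y|) -> 0 <= M ->
  exists P : {poly R}, (size P <= p.*2.+1)%N /\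
    forall x, -1 <= x <= 1 -> `|g x - P.[x]| <= 7 / 2 * M / p.+1%:R.
Proof.
(* One node more than coefficients, so that the quadrature is also exact for the [n + 1]
   differences. *)
move=> gM M0; pose n := p.*2.+1; pose q := n.+1.
exists (jackson_poly n q (triangle p) g); split; first exact: size_jackson_poly.
move=> x x1; pose th := acos x.
have xE : x = cos th by rewrite /th acosK// in_itv.
set A := \sum_(k < n) triangle p k ^+ 2.
have P0 : 0 < p.+1%:R :> R by rewrite ltr0n.
have A3 : p.+1%:R ^+ 3 / 3 <= A := sum_triangle_ge p.
have A0 : 0 < A by apply: lt_le_trans A3; rewrite divr_gt0// exprn_gt0.
have q0 : 0 < q%:R :> R by rewrite ltr0n.
have qA : 0 < q%:R * A by rewrite mulr_gt0.
pose H j := jackson_ker n (triangle p) th (node q j).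
have H0 j : 0 <= H j by rewrite mulr_ge0 ?invr_ge0// addr_ge0// trig_sqr_ge0.
have HS : \sum_(j < q) H j = q%:R * A by rewrite sum_jackson_ker// ltnW.
have H2 : \sum_(j < q) (cos th - cos (node q j)) ^+ 2 * H j <= q%:R * q%:R.
  apply: (@le_trans _ _ (\sum_(j < q) jackson_ker n.+1
      (fun k => triangle p k - (if k is k'.+1 then triangle p k' else 0)) th (node q j))).
    by apply: ler_sum => j _; apply: sqr_dist_jackson_ker; rewrite /triangle /n subnn minn0.
  rewrite sum_jackson_ker// ler_pM2l//.
  apply: (@le_trans _ _ (\sum_(k < n.+1) 1)); first by apply: ler_sum => k _; exact: triangle_diff.
  by rewrite sumr_const card_ord.
have -> : g x - (jackson_poly n q (triangle p) g).[x] =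
    (q%:R * A)^-1 * \sum_(j < q) (g (cos th) - g (cos (node q j))) * H j.
  rewrite {2}xE jackson_poly_cos -/A.
  under [in RHS]eq_bigr do rewrite mulrBl.
  rewrite sumrB -mulr_sumr HS mulrBr mulrCA mulVf ?gt_eqF// mulr1 -xE.
  by [].
rewrite normrM normfV (ger0_norm (ltW qA)) ler_pdivrMl//.
have cb t : -1 <= (cos t : R) <= 1 by rewrite cos_geN1 cos_le1.
pose w : R := p.+1%:R.
(* [|d| <= (w d^2 + 1 / w) / 2] with [w = p + 1]. The mean of [d^2] is at most [q / A <= 6 / w^2],
   which leads to the constant [(6 + 1) / 2]. *)
have step j : `|(g (cos th) - g (cos (node q j))) * H j| <=
    M / 2 * (w * ((cos th - cos (node q j)) ^+ 2 * H j) + w^-1 * H j).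
  rewrite normrM (ger0_norm (H0 j)).
  apply: (@le_trans _ _ (M * `|cos th - cos (node q j)| * H j)).
    by rewrite ler_wpM2r// gM.
  have -> : M / 2 * (w * ((cos th - cos (node q j)) ^+ 2 * H j) + w^-1 * H j) =
    M * (2^-1 * (w * `|cos th - cos (node q j)| ^+ 2 + w^-1)) * H j.
    by rewrite real_normK ?num_real//; ring.
  rewrite ler_wpM2r// ler_wpM2l//.
  move: `|_| => z; rewrite -(ler_pM2l P0) -/w.
  have -> : w * (2^-1 * (w * z ^+ 2 + w^-1)) = 2^-1 * ((w * z) ^+ 2 + 1) by field; rewrite gt_eqF.
  have := sqr_ge0 (w * z - 1); nra.
apply: (le_trans (ler_norm_sum _ _ _)).
apply: (@le_trans _ _ (\sum_(j < q) M / 2 * (w * ((cos th - cos (node q j)) ^+ 2 * H j) + w^-1 * H j))).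
  by apply: ler_sum => j _; exact: step.
rewrite -mulr_sumr big_split /= -[X in _ * (_ + X)]mulr_sumr HS -[X in _ * (X + _)]mulr_sumr.
have qw : q%:R = 2 * w by rewrite /q /n /w -addnn -addSn -addnS natrD; ring.
have hw : w * (w * w) <= 3 * A by move: A3; rewrite -/w ler_pdivrMr//; lra.
apply: (@le_trans _ _ (M / 2 * (w * (q%:R * q%:R) + w^-1 * (q%:R * A)))).
  by rewrite ler_wpM2l ?divr_ge0// lerD2r ler_pM2l.
have -> : q%:R * A * (7 / 2 * M / w) = M / 2 * (w^-1 * q%:R * (7 * A)) by field; rewrite gt_eqF.
rewrite ler_wpM2l ?divr_ge0//.
have -> : w * (q%:R * q%:R) + w^-1 * (q%:R * A) = w^-1 * q%:R * (w * w * q%:R + A) by field; rewrite gt_eqF.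
by rewrite ler_wpM2l ?mulr_ge0 ?invr_ge0 ?(ltW q0) ?(ltW P0)// qw; lra.
Qed.

End Jackson.

(** * Transfer of the estimate to [[a, b]] and to functions with a bounded derivative *)

Section UniformApproximation.
Context {R : realType}.
Implicit Types (a b M : R) (f g df : R -> R).

Lemma has_derivative_on_near a b f df x e : has_derivative_on a b f df ->
  a <= x <= b -> 0 < e -> exists2 de, 0 < de &
    forall y, a <= y <= b -> y != x -> `|x - y| < de -> `|df x - (f y - f x) / (y - x)| < e.
Proof.
move=> fdf xab e0; have := fdf x; rewrite in_itv /= => /(_ xab) /cvgrPdist_lt /(_ e e0).
rewrite near_withinE /dnbhs near_withinE => /nbhs_ballP [de /= de0 H].
exists de => // y yab yx xy; apply: (H y) => //=.
Qed.

(** Mean value theorem on [[x, y]]: interior points have a two-sided derivative, and continuity up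
    to the endpoints follows from locally bounded difference quotients. *)
Lemma has_derivative_on_lipschitz a b f df M : has_derivative_on a b f df ->
  (forall x, x \in `[a, b] -> `|df x| <= M) ->
  forall x y, a <= x <= b -> a <= y <= b -> `|f x - f y| <= M * `|x - y|.
Proof.
move=> fdf dfM.
suff H x y : a <= x -> x < y -> y <= b -> `|f y - f x| <= M * (y - x).
  move=> x y /andP[ax xb] /andP[ay yb]; have [xy|yx|->] := ltgtP x y.
  - by rewrite distrC (distrC x) (ger0_norm (_ : 0 <= y - x)) ?H// subr_ge0 ltW.
  - by rewrite (ger0_norm (_ : 0 <= x - y)) ?H// subr_ge0 ltW.
  - by rewrite !subrr normr0 mulr0.
move=> ax xy yb.
have sub z : x <= z <= y -> a <= z <= b.
  by move=> /andP[xz zy]; rewrite (le_trans ax)//= (le_trans zy).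
have fder z : z \in `]x, y[ -> is_derive z 1 f (df z).
  rewrite in_itv /= => /andP[xz zy].
  suff H : (fun h : R => h^-1 *: (f (h *: 1 + z) - f z)) @ 0^' --> df z.
    by apply: DeriveDef; [apply/cvg_ex; exists (df z)|exact: cvg_lim H].
  apply/cvgrPdist_lt => e e0.
  have [de de0 H] := has_derivative_on_near fdf (sub z (introT andP (conj (ltW xz) (ltW zy)))) e0.
  rewrite near_withinE; apply/nbhs_ballP.
  exists (Num.min de (Num.min (z - x) (y - z))) => /=.
    by rewrite !lt_min de0 !subr_gt0 xz zy.
  move=> h /=; rewrite -ball_normE /ball_ /= sub0r normrN !lt_min => /and3P[h1 h2 h3] h0.
  rewrite -[h *: 1]/(h * 1) mulr1 -[_ *: _]/(_ * _) mulrC.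
  have := H (h + z); rewrite addrK; apply.
  - by move: h2 h3; rewrite !ltr_norml => /andP[? ?] /andP[? ?]; apply: sub; apply/andP; split; lra.
  - by rewrite -subr_eq0 addrK.
  - by rewrite opprD addrCA subrr addr0 normrN.
have fcont : {within `[x, y], continuous f}.
  apply/subspace_continuousP => z /= zxy; apply/cvgrPdist_lt => e e0.
  have zab : a <= z <= b by apply: sub; move: zxy; rewrite in_itv.
  have [de de0 H] := has_derivative_on_near fdf zab ltr01.
  have D0 : 0 < `|df z| + 1 by rewrite ltr_wpDl.
  rewrite near_withinE; apply/nbhs_ballP.
  exists (Num.min de (e / (`|df z| + 1))) => /=; first by rewrite lt_min de0 divr_gt0.
  move=> u /=; rewrite -ball_normE /ball_ /= lt_min => /andP[u1 u2] uxy.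
  have [->|uz] := eqVneq u z; first by rewrite subrr normr0.
  have uab : a <= u <= b by apply: sub; move: uxy; rewrite in_itv.
  have H1 := H u uab uz u1.
  have uz0 : u - z != 0 by rewrite subr_eq0.
  have -> : f z - f u = - ((f u - f z) / (u - z)) * (u - z) by field.
  rewrite normrM normrN distrC.
  have H2 : `|(f u - f z) / (u - z)| <= `|df z| + 1.
    rewrite -[X in `|X|](subKr (df z)); apply: (le_trans (ler_normB _ _)).
    by rewrite lerD2l ltW.
  apply: (le_lt_trans (ler_wpM2r (normr_ge0 _) H2)).
  by rewrite mulrC -ltr_pdivlMr.
have [z zxy ->] := MVT xy fder fcont.
have yx0 : 0 <= y - x by rewrite subr_ge0 ltW.
rewrite normrM (ger0_norm yx0) ler_wpM2r//.
apply: dfM; rewrite in_itv /=; apply: sub; move: zxy; rewrite in_itv /= => /andP[? ?].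
by rewrite !ltW.
Qed.

(** The bound [C] guarantees that the supremum exists; for an unbounded set [sup] is 0 by
    default. *)
Lemma sup_norm_ge a b g C x : (forall y, a <= y <= b -> `|g y| <= C) -> a <= x <= b ->
  `|g x| <= sup_norm a b g.
Proof.
move=> gC xab; apply: ub_le_sup; last by exists x => //=; rewrite in_itv.
by exists C => _ [y /= yab <-]; apply: gC; rewrite in_itv in yab.
Qed.

Lemma sup_norm_le a b g C : a <= b -> (forall y, a <= y <= b -> `|g y| <= C) -> sup_norm a b g <= C.
Proof.
move=> ab gC; apply: ge_sup; first by exists `|g a|, a => //=; rewrite in_itv /= lexx.
by move=> _ [y /= yab <-]; apply: gC; rewrite in_itv in yab.
Qed.

Lemma sup_norm_ge0 a b g : 0 <= sup_norm a b g.
Proof.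
have [[_ [x xab _]]|/set0P/negP] := pselect ([set `|g x| | x in `[a, b]] !=set0).
  rewrite /sup_norm; have [hs|hs] := pselect (has_sup [set `|g x| | x in `[a, b]]).
    by apply: le_trans (ub_le_sup hs.2 (_ : _ `|g x|)); [exact: normr_ge0|exists x].
  by rewrite sup_out.
by rewrite negbK => /eqP e; rewrite /sup_norm e sup0.
Qed.

Lemma best_error_le a b N f p : polys_le N p ->
  best_error a b N f <= sup_norm a b (fun x => f x - p.[x]).
Proof.
move=> pN; apply: ge_inf; last by exists p.
by exists 0 => _ [q _ <-]; exact: sup_norm_ge0.
Qed.

Lemma jackson_best_error a b f M N : a < b -> (0 < N)%N -> 0 <= M ->
  (forall x y, a <= x <= b -> a <= y <= b -> `|f x - f y| <= M * `|x - y|) ->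
  best_error a b N f <= 7 / 2 * (b - a) * M / N%:R.
Proof.
move=> ab N0 M0 fM; have ba0 : 0 < b - a by rewrite subr_gt0.
pose g t := f ((a + b) / 2 + t * ((b - a) / 2)).
have gM x y : -1 <= x <= 1 -> -1 <= y <= 1 -> `|g x - g y| <= M * ((b - a) / 2) * `|x - y|.
  have inab t : -1 <= t <= 1 -> a <= (a + b) / 2 + t * ((b - a) / 2) <= b.
    by move=> /andP[? ?]; apply/andP; split; nra.
  move=> /inab hx /inab hy; apply: (le_trans (fM _ _ hx hy)).
  rewrite -mulrA ler_wpM2l// -[X in X * `|_|](ger0_norm (_ : 0 <= (b - a) / 2));
    last by rewrite divr_ge0 ?ltW.
  by rewrite -normrM le_eqVlt; apply/orP; left; apply/eqP; congr `|_|; ring.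
(* With [p = N./2] the degree [2 p] is at most [N], and [N <= 2 (p + 1)] turns the half-length
   [(b - a) / 2] over [p + 1] into at most [(b - a) / N]. *)
have [P [sP HP]] := jackson_unit (N./2) gM (mulr_ge0 M0 (divr_ge0 (ltW ba0) (ler0n R 2))).
pose aff : {poly R} := (2 / (b - a)) *: 'X - ((a + b) / (b - a))%:P.
have affE x : aff.[x] = (2 * x - (a + b)) / (b - a).
  by rewrite hornerD hornerN hornerZ hornerX hornerC; field; rewrite gt_eqF.
have sQ : polys_le N (P \Po aff).
  have [->|P0] := eqVneq P 0; first by rewrite /polys_le /= comp_poly0 size_poly0.
  have sa : (size aff <= 2)%N.
    rewrite (leq_trans (size_polyD _ _))// geq_max size_polyN size_polyC.
    rewrite (leq_trans (size_scale_leq _ _)) ?size_polyX//=.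
    by case: (_ != 0).
  have := size_comp_poly_leq P aff; rewrite /polys_le /=.
  have h : ((size P).-1 * (size aff).-1 <= (size P).-1 * 1)%N by rewrite leq_mul2l; lia.
  move: sP; have := odd_double_half N; move: (size _) (size _) h; lia.
apply: (le_trans (best_error_le a b f sQ)); apply: sup_norm_le (ltW ab) _ => y /andP[ay yb].
rewrite horner_comp affE; set t := (2 * y - (a + b)) / (b - a).
have -> : f y = g t by rewrite /g /t; congr f; field; rewrite gt_eqF.
have t1 : -1 <= t <= 1.
  by rewrite /t ler_pdivlMr// ler_pdivrMr//; apply/andP; split; lra.
apply: (le_trans (HP t t1)).
have NN : N%:R <= 2 * (N./2).+1%:R :> R.
  by rewrite -natrM ler_nat; have := odd_double_half N; lia.
have n0 : 0 < N%:R :> R by rewrite ltr0n.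
have p0 : 0 < (N./2).+1%:R :> R by rewrite ltr0n.
have -> : 7 / 2 * (M * ((b - a) / 2)) / (N./2).+1%:R = 7 / 2 * (b - a) * M * (2 * (N./2).+1%:R)^-1.
  by field; rewrite gt_eqF.
rewrite ler_wpM2l ?mulr_ge0 ?(ltW ba0)// ?invr_ge0//.
by rewrite lef_pV2 ?posrE ?mulr_gt0.
Qed.

End UniformApproximation.

(** * Recovery by l1 minimization *)

Section Recovery.
Context {R : realType}.

Lemma lp_norm1E n (z : 'cV[R]_n) : lp_norm 1 z = \sum_j `|z j 0|.
Proof.
rewrite /lp_norm invr1 powRr1; last by apply: sumr_ge0 => j _; exact: powR_ge0.
by apply: eq_bigr => j _; rewrite powRr1.
Qed.

Lemma lp_norm2E n (z : 'cV[R]_n) : lp_norm 2 z = Num.sqrt (\sum_j z j 0 ^+ 2).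
Proof.
rewrite /lp_norm powR12_sqrt; last by apply: sumr_ge0 => j _; exact: powR_ge0.
by congr Num.sqrt; apply: eq_bigr => j _; rewrite powR_mulrn// real_normK ?num_real.
Qed.

(* The set keeps the entries above [|z|_q s^(-1/q)], so no sorting is needed. *)
Lemma stechkin n (z : 'cV[R]_n) (q : R) (s : nat) : 0 < q < 1 -> (0 < s)%N ->
  exists S : {set 'I_n}, (#|S| <= s)%N /\
    \sum_(k | k \notin S) `|z k 0| <= s%:R `^ (1 - q^-1) * lp_norm q z.
Proof.
move=> /andP[q0 q1] s0; have sR : 0 < s%:R :> R by rewrite ltr0n.
have q0' := lt0r_neq0 q0.
pose Q := \sum_j `|z j 0| `^ q.
have Q0 : 0 <= Q by apply: sumr_ge0 => j _; exact: powR_ge0.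
pose t := lp_norm q z * s%:R `^ (- q^-1).
have t0 : 0 <= t by rewrite mulr_ge0 ?powR_ge0.
have tq : t `^ q = Q / s%:R.
  by rewrite powRM ?powR_ge0// -!powRrM mulVf// mulNr mulVf// powRr1// powRN powRr1// ltW.
have st : s%:R * t = s%:R `^ (1 - q^-1) * lp_norm q z.
  rewrite powRD; last by apply/implyP => _; rewrite gt_eqF.
  by rewrite powRr1 ?ltW// /t; ring.
pose S := [set k | t < `|z k 0|]%SET; exists S; split.
  have [Qz|Qn0] := eqVneq Q 0.
    rewrite leqNgt; apply/negP => /ltnW; rewrite leqNgt; apply/negP/negPn.
    suff -> : #|S| = 0%N by [].
    apply: eq_card0 => k; rewrite !inE; apply/negbTE; rewrite -leNgt.
    have /eqP : `|z k 0| `^ q = 0.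
      have /eqP := Qz; rewrite psumr_eq0 => [/allP /(_ k)|j _]; last exact: powR_ge0.
      by rewrite mem_index_enum => /(_ isT) /eqP.
    by rewrite powR_eq0 => /andP[/eqP -> _].
  have Qp : 0 < Q by rewrite lt0r Qn0.
  (* Markov's inequality: each entry of [S] contributes at least [t^q = Q / s] to [Q]. *)
  have h : #|S|%:R * (Q / s%:R) <= Q.
    rewrite -tq mulr_natl -sumr_const.
    apply: (@le_trans _ _ (\sum_(k in S) `|z k 0| `^ q)).
      apply: ler_sum => k; rewrite inE => tk.
      by apply: ge0_ler_powR; rewrite ?nnegrE// ltW.
    by rewrite /Q [leRHS](bigID (mem S))/= lerDl sumr_ge0// => k _; exact: powR_ge0.
  have : #|S|%:R <= s%:R :> R.
    by move: h; rewrite mulrA ler_pdivrMr// [Q * _]mulrC ler_pM2r.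
  by rewrite ler_nat.
rewrite -st.
(* Off [S], the entry [|z|] splits as [|z|^q |z|^(1 - q)] with second factor at most [t^(1 - q)];
   summing gives the right-hand side. *)
have -> : s%:R * t = Q * t `^ (1 - q).
  have -> : Q = s%:R * t `^ q by rewrite tq mulrC divfK ?gt_eqF.
  rewrite -mulrA; congr (_ * _); have [->|tn0] := eqVneq t 0.
    by rewrite powR0// mul0r.
  by rewrite -powRD ?tn0 ?implybT// addrC subrK powRr1.
rewrite mulr_suml; apply: (@le_trans _ _ (\sum_(k | k \notin S) `|z k 0| `^ q * t `^ (1 - q))).
  apply: ler_sum => k; rewrite inE -leNgt => kt.
  have [->|zn0] := eqVneq `|z k 0| 0; first by rewrite mulr_ge0// powR_ge0.
  have E : `|z k 0| `^ q * `|z k 0| `^ (1 - q) = `|z k 0|.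
    by rewrite -powRD ?zn0 ?implybT// addrC subrK powRr1.
  rewrite -[leLHS]E ler_wpM2l ?powR_ge0//.
  by apply: ge0_ler_powR; rewrite ?nnegrE// subr_ge0 ltW.
rewrite [leRHS](bigID (fun k => k \notin S))/= lerDl sumr_ge0// => k _.
by rewrite mulr_ge0// powR_ge0.
Qed.

Lemma cauchy_schwarz_card n (S : {set 'I_n}) (z : 'cV[R]_n) :
  \sum_(k in S) `|z k 0| <= Num.sqrt #|S|%:R * Num.sqrt (\sum_k z k 0 ^+ 2).
Proof.
set Q := \sum_k _; have Q0 : 0 <= Q by apply: sumr_ge0 => k _; exact: sqr_ge0.
have [S0|Sn0] := eqVneq #|S| 0%N.
  by rewrite big_pred0 ?mulr_ge0 ?sqrtr_ge0// => k; apply/negP => kS; move: S0; rewrite (cardD1 k) kS.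
have Sp : 0 < #|S|%:R :> R by rewrite ltr0n lt0n.
set u := Num.sqrt #|S|%:R; have u0 : 0 < u by rewrite sqrtr_gt0.
have uu : u ^+ 2 = #|S|%:R by rewrite sqr_sqrtr// ltW.
set v := Num.sqrt Q; have v0 : 0 <= v by exact: sqrtr_ge0.
have vv : v ^+ 2 = Q by rewrite sqr_sqrtr.
have [vz|vn0] := eqVneq v 0.
  have Qz : Q = 0 by rewrite -vv vz expr0n.
  rewrite big1 ?mulr_ge0 ?(ltW u0)// => k _; apply/eqP; rewrite normr_eq0 -sqrf_eq0.
  have /eqP := Qz; rewrite psumr_eq0 => [/allP /(_ k)|j _]; last exact: sqr_ge0.
  by rewrite mem_index_enum => /(_ isT).
have vp : 0 < v by rewrite lt0r vn0.
(* The arithmetic-geometric inequality, with weights for which each of the two sums is at most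
   [u v / 2]. *)
apply: (@le_trans _ _ (\sum_(k in S) (u / (2 * v) * z k 0 ^+ 2 + v / (2 * u)))).
  apply: ler_sum => k _; rewrite -[z k 0 ^+ 2]real_normK ?num_real//.
  move: `|_| => y; have c0 : 0 < 2 * u * v by rewrite !mulr_gt0.
  rewrite -(ler_pM2l c0).
  have -> : 2 * u * v * (u / (2 * v) * y ^+ 2 + v / (2 * u)) = (u * y) ^+ 2 + v ^+ 2.
    by field; rewrite vn0 gt_eqF.
  have := sqr_ge0 (u * y - v); nra.
rewrite big_split /= -mulr_sumr sumr_const -[_ *+ #|S|]mulr_natl -uu.
have : \sum_(k in S) z k 0 ^+ 2 <= v ^+ 2.
  by rewrite vv /Q [leRHS](bigID (mem S))/= lerDl sumr_ge0// => k _; exact: sqr_ge0.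
move=> h; have c0 : 0 <= u / (2 * v) by rewrite divr_ge0 ?mulr_ge0 ?ltW.
apply: (le_trans (lerD (ler_wpM2l c0 h) (lexx _))).
by rewrite le_eqVlt; apply/orP; left; apply/eqP; field; rewrite vn0 gt_eqF.
Qed.

Lemma l1_cone n (c c0 : 'cV[R]_n) (S : {set 'I_n}) (sg : R) :
  lp_norm 1 c <= lp_norm 1 c0 -> \sum_(k | k \notin S) `|c0 k 0| <= sg ->
  \sum_k `|(c - c0) k 0| <= 2 * \sum_(k in S) `|(c - c0) k 0| + 2 * sg.
Proof.
rewrite !lp_norm1E => cc0 hs.
rewrite (bigID (mem S))/=; rewrite (bigID (mem S)) [X in _ <= X](bigID (mem S))/= in cc0.
have h1 : \sum_(k in S) `|c0 k 0| <= \sum_(k in S) `|c k 0| + \sum_(k in S) `|(c - c0) k 0|.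
  rewrite -big_split /=; apply: ler_sum => k _; rewrite !mxE.
  by rewrite -[X in `|X| <= _](subKr (c k 0)) ler_normB.
have h2 : \sum_(k | k \notin S) `|(c - c0) k 0| <=
    \sum_(k | k \notin S) `|c k 0| + \sum_(k | k \notin S) `|c0 k 0|.
  by rewrite -big_split /=; apply: ler_sum => k _; rewrite !mxE ler_normB.
lra.
Qed.

End Recovery.

(** * Coefficients in the basis [psi] and the error of the minimizer *)

Section Span.
Context {R : realType} (N : nat) (psi : 'I_N.+1 -> {poly R}).
Hypothesis psi_incr : forall j k : 'I_N.+1, (j < k)%N -> (size (psi j) < size (psi k))%N.
Hypothesis psi_le : forall k, polys_le N (psi k).
Hypothesis psi0 : psi ord0 != 0.

(** [N + 1] strictly increasing sizes between 1 and [N + 1] leave no gap; [psi0] gives the lower end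
    and [psi_le] the upper one. *)
Lemma size_psi (k : 'I_N.+1) : size (psi k) = k.+1.
Proof.
have H n (i j : 'I_N.+1) : j = (i + n)%N :> nat -> (size (psi i) + n <= size (psi j))%N.
  elim: n j => [|n IH] j ji.
    by rewrite addn0; have -> : j = i by apply: val_inj; rewrite /= ji addn0.
  have ji' : (i + n < N.+1)%N by have := ltn_ord j; lia.
  have h1 := IH (Ordinal ji') erefl.
  have /psi_incr h2 : (Ordinal ji' < j)%N by rewrite /= ji; lia.
  lia.
have := H k ord0 k erefl; have := H (N - k)%N k ord_max.
have : (0 < size (psi ord0))%N by rewrite lt0n size_poly_eq0.
have := psi_le ord_max; rewrite /polys_le /=; have := ltn_ord k.
move=> kN a1 a2 a3 a4; have := a3 (ltac:(lia)); lia.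
Qed.

Lemma lcombD (c e : 'cV[R]_N.+1) : lcomb psi (c + e) = lcomb psi c + lcomb psi e.
Proof. by rewrite /lcomb -big_split; apply: eq_bigr => k _; rewrite mxE scalerDl. Qed.

Lemma lcombN (c : 'cV[R]_N.+1) : lcomb psi (- c) = - lcomb psi c.
Proof. by rewrite /lcomb -sumrN; apply: eq_bigr => k _; rewrite mxE scaleNr. Qed.

Lemma lcomb_delta (e : R) k : lcomb psi (e *: delta_mx k 0) = e *: psi k.
Proof.
rewrite /lcomb (bigD1 k)//= big1 => [|i ik]; last by rewrite !mxE (negPf ik) mulr0 scale0r.
by rewrite !mxE !eqxx mulr1 addr0.
Qed.

Lemma lcomb_span n (p : {poly R}) : (n <= N.+1)%N -> (size p <= n)%N ->
  exists c, p = lcomb psi c.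
Proof.
elim: n p => [|n IH] p nN pn.
  exists 0; move: pn; rewrite leqn0 size_poly_eq0 => /eqP ->.
  by rewrite /lcomb big1// => k _; rewrite mxE scale0r.
pose k := Ordinal nN.
have lk : (psi k)`_n != 0.
  have := size_psi k => /= sk; have : lead_coef (psi k) != 0.
    by rewrite lead_coef_eq0 -size_poly_eq0 sk.
  by rewrite lead_coefE sk.
pose e := p`_n / (psi k)`_n.
have [c pc] : exists c, p - e *: psi k = lcomb psi c.
  apply: IH; first exact: ltnW.
  apply/leq_sizeP => j nj; rewrite coefB coefZ.
  have [->|jn] := eqVneq j n; first by rewrite /e divfK// subrr.
  have nj' : (n < j)%N by rewrite ltn_neqAle eq_sym jn.
  rewrite nth_default ?(leq_trans pn)// nth_default ?mulr0 ?subrr//.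
  by rewrite size_psi.
by exists (c + e *: delta_mx k 0); rewrite lcombD -pc lcomb_delta subrK.
Qed.

Lemma lcomb_coefs (p : {poly R}) : polys_le N p -> lcomb psi (coefs psi p) = p.
Proof.
move=> pN; have [c pc] := lcomb_span (leqnn _) pN.
by have := @xgetPex _ 0 [set c : 'cV[R]_N.+1 | p = \sum_(k < N.+1) c k 0 *: psi k] (ex_intro _ c pc).
Qed.

Variables (a b K E Th : R) (f : R -> R) (m L s : nat) (x : 'I_m -> R).
Hypotheses (K1 : 1 <= K) (E0 : 0 <= E) (Th1 : 1 <= Th) (m0 : (0 < m)%N).
Hypothesis psiK : forall k y, a <= y <= b -> `|(psi k).[y]| <= K.
Hypothesis xab : forall j, a <= x j <= b.
Hypotheses (sL : (s <= 4 ^ L)%N) (Ls : (4 ^ L <= 4 * s)%N).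
Hypothesis re : forall h : 'cV[R]_N.+1,
  \sum_k `|h k 0| <= 2 ^+ L.+2 * Num.sqrt (\sum_k h k 0 ^+ 2) ->
  \sum_k h k 0 ^+ 2 <= 768 * (m%:R^-1 * \sum_j (lcomb psi h).[x j] ^+ 2).

Let A := \matrix_(j < m, k < N.+1) (psi k).[x j].
Let y := \col_(j < m) f (x j).

Lemma residualE (c : 'cV[R]_N.+1) j : (A *m c - y) j 0 = (lcomb psi c).[x j] - f (x j).
Proof.
rewrite !mxE horner_sum; congr (_ - _); apply: eq_bigr => k _.
by rewrite !mxE hornerZ mulrC.
Qed.

Lemma l1_recovery (c c0 : 'cV[R]_N.+1) (S : {set 'I_N.+1}) (sg : R) :
  (forall t, a <= t <= b -> `|f t - (lcomb psi c0).[t]| <= E) ->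
  (#|S| <= s)%N -> \sum_(k | k \notin S) `|c0 k 0| <= sg ->
  is_l1_minimizer A y (Th * Num.sqrt m%:R * E) c ->
  \sum_k `|(c - c0) k 0| <= 4 * sg + 448 * Num.sqrt s%:R * Th * E.
Proof.
move=> fE Ss hsg [cfeas cmin].
have mR : 0 < m%:R :> R by rewrite ltr0n.
have Th0 : 0 <= Th := le_trans ler01 Th1.
have resid (z : 'cV[R]_N.+1) : lp_norm 2 (A *m z - y) <= Th * Num.sqrt m%:R * E <->
    \sum_j ((lcomb psi z).[x j] - f (x j)) ^+ 2 <= m%:R * (Th * E) ^+ 2.
  rewrite lp_norm2E; under eq_bigr do rewrite residualE.
  have -> : Th * Num.sqrt m%:R * E = Num.sqrt (m%:R * (Th * E) ^+ 2).
    rewrite sqrtrM ?ler0n// sqrtr_sqr ger0_norm ?mulr_ge0//; ring.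
  by rewrite ler_psqrt// nnegrE ?mulr_ge0 ?sqr_ge0// sumr_ge0// => j _; exact: sqr_ge0.
have c0feas : lp_norm 2 (A *m c0 - y) <= Th * Num.sqrt m%:R * E.
  apply/resid; rewrite mulr_natl -[X in _ *+ X]card_ord -sumr_const; apply: ler_sum => j _.
  rewrite -[leLHS]real_normK ?num_real// lerXn2r ?nnegrE ?mulr_ge0// distrC.
  by apply: (le_trans (fE _ (xab j))); rewrite ler_peMl.
have cone := l1_cone (cmin _ c0feas) hsg.
have sg0 : 0 <= sg by apply: le_trans hsg; exact: sumr_ge0.
move/resid: cfeas => cfeas; move/resid: c0feas => c0feas.
set h := c - c0 in cone *; set H1 := \sum_k `|h k 0| in cone *.
pose v := Num.sqrt (\sum_k h k 0 ^+ 2).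
have v0 : 0 <= v by exact: sqrtr_ge0.
have p2 : 0 < 2 ^+ L :> R by exact: exprn_gt0.
have e4 : (2 ^+ L) ^+ 2 = 4 ^+ L :> R by rewrite -exprM mulnC exprM; congr (_ ^+ _); ring.
have r0 : 0 <= Num.sqrt s%:R :> R by exact: sqrtr_ge0.
have rr : Num.sqrt s%:R ^+ 2 = s%:R :> R by rewrite sqr_sqrtr.
have sL2 : Num.sqrt s%:R <= 2 ^+ L :> R.
  by rewrite -(ler_pXn2r (ltn0Sn 1)) ?nnegrE ?(ltW p2)// rr e4 -natrX ler_nat.
have L2s : 2 ^+ L <= 2 * Num.sqrt s%:R :> R.
  rewrite -(ler_pXn2r (ltn0Sn 1)) ?nnegrE ?mulr_ge0 ?(ltW p2)// e4 (exprMn _ 2 (Num.sqrt _)) rr.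
  have : (4 ^ L)%:R <= (4 * s)%:R :> R by rewrite ler_nat.
  by rewrite natrX natrM; move: (4 ^+ L) => z; lra.
have rest0 : 0 <= 448 * Num.sqrt s%:R * Th * E.
  exact: (mulr_ge0 (mulr_ge0 (mulr_ge0 (ler0n _ _) r0) Th0) E0).
(* If the eigenvalue bound does not apply, Cauchy-Schwarz on at most [s <= 4^L] entries bounds the
   sum over [S] by [2^L v < H1 / 4], and the cone condition yields [H1 <= 4 sg]. *)
have [hle|hgt] := leP H1 (2 ^+ L.+2 * v); last first.
  have hS : \sum_(k in S) `|h k 0| <= 2 ^+ L * v.
    apply: (le_trans (cauchy_schwarz_card S h)); rewrite ler_wpM2r//.
    by apply: le_trans sL2; rewrite ler_sqrt ?ler0n// ler_nat.
  have : 4 * (2 ^+ L * v) < H1.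
    by move: hgt; rewrite 2!exprS; lra.
  lra.
(* [c] and [c0] are both feasible, so the residual of their difference costs a factor [2 + 2], and
   [768 * 4 = 3072 <= 56^2]. Then [448 = 8 * 56], since [2^(L + 2) <= 8 sqrt s]. *)
have Q2 : v ^+ 2 <= 3072 * (Th * E) ^+ 2.
  rewrite sqr_sqrtr; last by apply: sumr_ge0 => k _; exact: sqr_ge0.
  apply: (le_trans (re hle)).
  have -> : 3072 = 768 * 4 :> R by ring.
  rewrite -mulrA ler_wpM2l ?ler0n// mulrC ler_pdivrMr//.
  apply: (@le_trans _ _ (\sum_j (2 * ((lcomb psi c).[x j] - f (x j)) ^+ 2
    + 2 * ((lcomb psi c0).[x j] - f (x j)) ^+ 2))).
    apply: ler_sum => j _; rewrite /h lcombD lcombN hornerD hornerN.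
    move: (horner _ _) (horner _ _) (f _) => u1 u2 u3; have := sqr_ge0 (u1 + u2 - 2 * u3); nra.
  by rewrite big_split /= -!mulr_sumr; lra.
have TE0 : 0 <= Th * E by rewrite mulr_ge0.
have v56 : v <= 56 * (Th * E).
  rewrite -(ler_pXn2r (ltn0Sn 1)) ?nnegrE//; last by apply: mulr_ge0; [exact: ler0n|].
  by apply: (le_trans Q2); have := sqr_ge0 (Th * E); move: (Th * E) => z; lra.
have : 2 ^+ L.+2 * v <= 8 * Num.sqrt s%:R * (56 * (Th * E)).
  apply: ler_pM => //; by rewrite 2!exprS; lra.
move=> hh; have := le_trans hle hh; lra.
Qed.

End Span.

(** * Comparison of [L] with [ln s], and the final constants *)

Section Sparsity.
Context {R : realType}.

(** From [1 <= ln 4 <= 3]. [L] exceeds [trunc_log 4 s <= ln s] by one, and [ln s >= 1/2] for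
    [s >= 2] gives [ln s + 1 <= 3 ln s]. *)
Lemma trunc_log_ln_bounds (s : nat) : (1 < s)%N -> let L := (trunc_log 4 s).+1 in
  [/\ (s <= 4 ^ L)%N, (4 ^ L <= 4 * s)%N, ln s%:R <= 3 * L%:R :> R & L%:R <= 3 * ln s%:R :> R].
Proof.
move=> s1 L; have s0 : (0 < s)%N by exact: ltnW.
have /andP[lo hi] := trunc_log_bounds (isT : (1 < 4)%N) s0.
have sR : 0 < s%:R :> R by rewrite ltr0n.
have ln4 : ln 4 <= 3 :> R.
  have := @expR_ge1Dx R 3 => h; rewrite -[leRHS]expRK ler_ln ?posrE ?expR_gt0//.
have ln_inv (x : R) : 0 < x -> 1 - x^-1 <= ln x.
  move=> x0; have := expR_ge1Dx (- ln x); rewrite expRN lnK ?posrE// => h; lra.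
split.
- exact: ltnW.
- by rewrite expnS leq_mul2l.
- apply: (@le_trans _ _ (ln ((4 ^ L)%:R : R))).
    by rewrite ler_ln ?posrE ?ltr0n ?expn_gt0// ler_nat ltnW.
  by rewrite natrX lnXn// -[leLHS]mulr_natr ler_wpM2r.
- have h1 : (trunc_log 4 s)%:R <= ln s%:R :> R.
    apply: (@le_trans _ _ (ln ((4 ^ trunc_log 4 s)%:R : R))); last first.
      by rewrite ler_ln ?posrE ?ltr0n ?expn_gt0// ler_nat.
    rewrite natrX lnXn// -[leRHS]mulr_natl ler_peMr//.
    have -> : 4 = 2 ^+ 2 :> R by ring.
    rewrite lnXn// -[leRHS]mulr_natr; have := ln_inv 2 (ltr0Sn _ 1); lra.
  have h2 : 2^-1 <= ln s%:R :> R.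
    apply: le_trans (ln_inv _ sR).
    have : s%:R^-1 <= 2^-1 :> R by rewrite lef_pV2 ?posrE// ler_nat.
    lra.
  by rewrite /L -natr1; lra.
Qed.

(** [1 <= K r Th] lets the lone [E] join the term with 448, and [449 * 7 / 2] is below
    [1800 = 6 * 300]. *)
Lemma recovery_sum_le (E K H sg r Th B : R) :
  0 <= E -> 1 <= K * r * Th -> 0 <= B * r -> E <= 7 / 2 * B ->
  K * H <= K * (4 * sg + 448 * r * Th * E) ->
  E + K * H <= K * 4 * sg + (1800 * (B * (K * r * Th)) + 6 * (B * r)).
Proof.
move=> E0 KrT Br EB hKH.
have h1 : E * (K * r * Th) <= 7 / 2 * B * (K * r * Th) by rewrite ler_wpM2r// (le_trans ler01).
have h2 : E * 1 <= E * (K * r * Th) by rewrite ler_wpM2l.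
have B0 : 0 <= B by lra.
have h3 : 0 <= B * (K * r * Th) by rewrite mulr_ge0// (le_trans ler01).
lra.
Qed.

End Sparsity.

Theorem corollary3p2 (R : realType) :
  exists C0 D1 D2 gamma : R,
    [/\ 0 < C0, 0 < D1, 0 < D2 & 0 < gamma] /\
    forall (q : R) (Theta : nat) (a b : R) (nu : R -> R) (N m s : nat) (K : R)
      (psi : 'I_N.+1 -> {poly R})
      (d : measure_display) (T : measurableType d) (P : probability T R)
      (X : 'I_m -> {RV P >-> R})
      (f df : R -> R) (M1 : R) (popt : {poly R}),
    0 < q < 1 ->
    (0 < Theta)%N ->
    a < b ->
    is_prob_density a b nu ->
    (0 < N)%N -> (0 < m)%N -> (0 < s)%N ->
    1 <= K ->
    C0 * K ^+ 2 * s%:R * ln s%:R ^+ 3 * ln N.+1%:R <= m%:R ->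
    orthonormal_wrt a b nu psi ->
    (forall j k : 'I_N.+1, (j < k)%N -> (size (psi j) < size (psi k))%N) ->
    (forall k : 'I_N.+1, polys_le N (psi k)) ->
    (forall k : 'I_N.+1, sup_norm a b (fun x => (psi k).[x]) <= K) ->
    iid_sample a b nu X ->
    has_derivative_on a b f df ->
    (forall x, x \in `[a, b] -> `|df x| <= M1) ->
    is_best_approx a b N f popt ->
    with_prob_ge P (1 - N.+1%:R `^ (- (gamma * ln s%:R ^+ 3)))
      (fun w => forall c : 'cV[R]_N.+1,
         is_l1_minimizer
           (\matrix_(j < m, k < N.+1) (psi k).[X j w])
           (\col_(j < m) f (X j w))
           (Theta%:R * Num.sqrt m%:R * best_error a b N f) c ->
         sup_norm a b (fun x => f x - (\sum_(k < N.+1) c k 0 *: psi k).[x])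
         <= K * D1 * A_norm psi q popt * s%:R `^ (1 - q^-1)
            + 6 * (b - a) * M1 * (K * D2 * Theta%:R + 1)
              * (Num.sqrt s%:R / N%:R)).
Proof.
pose C1 : R := 2 * 2 ^+ 23 * 4096 * 16.
have C10 : 0 < C1.
  by do 2 (apply: mulr_gt0; last exact: ltr0Sn); apply: mulr_gt0 => //; exact: exprn_gt0.
(* [108 = 4 * 27] comes from [4^L <= 4 s] and [L <= 3 ln s], and [27^-1] from [ln s <= 3 L]; 4 is
   the factor of [sg] in [l1_recovery], and 300 becomes the 1800 of [recovery_sum_le]. *)
exists (C1 * 108), 4, 300, 27^-1.
split.
  split; [|exact: ltr0Sn|exact: ltr0Sn|by rewrite invr_gt0; exact: ltr0Sn].
  by apply: mulr_gt0 => //; exact: ltr0Sn.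
move=> q Th a b nu N m s K psi d T P X f df M1 popt q01 Th0 ab nuP N0 m0 s0 K1 Cm orth psi_incr
  psi_le psi_sup iidX fdf dfM poptP.
(* For [s = 1] the logarithm vanishes and the claimed probability is [1 - 1 = 0]: the empty event is
   enough. *)
have [s1|s1] := leqP s 1.
  have -> : s = 1%N by lia.
  exists set0; split => //; first by rewrite ln1 expr0n mulr0 oppr0 powRr0 subrr measure0.
set L := (trunc_log 4 s).+1.
have [sL Ls lnL Lln] := @trunc_log_ln_bounds R s s1; rewrite -/L in sL Ls lnL Lln.
have psiK k x : a <= x <= b -> `|(psi k).[x]| <= K.
  move=> xab; have [C HC] := poly_itv_bound (psi k) a b.
  exact: (le_trans (@sup_norm_ge _ a b (fun x => (psi k).[x]) C x HC xab) (psi_sup k)).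
have LR : 1 <= L%:R :> R by rewrite ler1n.
have ln0 : 0 <= ln s%:R :> R by rewrite ln_ge0// ler1n.
have lnN0 : 0 < ln N.+1%:R :> R by exact: ln_natS_gt0.
have mL : 2 * 2 ^+ 23 * 4096 * 16 * K ^+ 2 * 4 ^+ L * L%:R ^+ 3 * ln N.+1%:R <= m%:R.
  rewrite -/C1; apply: le_trans Cm; rewrite ler_pM2r//.
  have -> : C1 * 108 * K ^+ 2 * s%:R * ln s%:R ^+ 3 = C1 * K ^+ 2 * (4 * s%:R) * (3 * ln s%:R) ^+ 3 by ring.
  have L3 : L%:R ^+ 3 <= (3 * ln s%:R) ^+ 3 :> R by rewrite lerXn2r ?nnegrE// mulr_ge0.
  have Ls' : 4 ^+ L <= 4 * s%:R :> R by rewrite -natrX -natrM ler_nat.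
  have CK : 0 <= C1 * K ^+ 2 by rewrite mulr_ge0 ?sqr_ge0// ltW.
  apply: ler_pM => //; first by rewrite mulr_ge0// exprn_ge0.
  by rewrite ler_wpM2l.
have psi0 : psi ord0 != 0.
  apply/eqP => p0; have := orth ord0 ord0; rewrite eqxx.
  under eq_integral do rewrite p0 horner0 !mul0r.
  by rewrite integral0 => /eqP; rewrite eqe eq_sym oner_eq0.
have [poptN poptE] := poptP.
have M0 : 0 <= M1.
  apply: le_trans (normr_ge0 (df a)) (dfM a _).
  by rewrite in_itv /= lexx ltW.
have flip := has_derivative_on_lipschitz fdf dfM.
set E := best_error a b N f in poptE *.
have E0 : 0 <= E by rewrite -poptE; exact: sup_norm_ge0.
have EJ : E <= 7 / 2 * (b - a) * M1 / N%:R by exact: jackson_best_error.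
have fE t : a <= t <= b -> `|f t - popt.[t]| <= E.
  move=> tab; rewrite -poptE.
  have [C HC] := poly_itv_bound popt a b.
  (* A crude uniform bound, which rules out the default value of the supremum. *)
  apply: (@sup_norm_ge _ a b (fun x => f x - popt.[x]) (`|f a| + M1 * (b - a) + C)) => // y yab.
  apply: (le_trans (ler_normB _ _)); apply: lerD; last exact: HC.
  rewrite -[f y](subrK (f a)); apply: (le_trans (ler_normD _ _)); rewrite addrC lerD2l.
  have aab : a <= a <= b by rewrite lexx ltW.
  apply: (le_trans (flip _ _ yab aab)); rewrite ler_wpM2l//.
  by case/andP: yab => ay yb; rewrite ger0_norm ?subr_ge0// lerD2r.
have := restricted_eigenvalue nuP iidX orth psiK N0 m0 (isT : (0 < L)%N) K1 mL.
apply: with_prob_ge_le.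
  rewrite lerD2l lerN2; apply: ler_powR; first by rewrite ler1n.
  rewrite lerN2 ler_pdivrMl; last exact: ltr0Sn.
  have -> : 27 * L%:R ^+ 3 = (3 * L%:R) ^+ 3 :> R by ring.
  by rewrite lerXn2r ?nnegrE// mulr_ge0.
move=> w re c cmin.
set c0 := coefs psi popt.
have c0E : lcomb psi c0 = popt := lcomb_coefs psi_incr psi_le psi0 poptN.
have [S [Ss Ssum]] := stechkin c0 q01 s0.
have xab j : a <= X j w <= b by case: iidX.
have Th1 : 1 <= Th%:R :> R by rewrite ler1n.
have fE' t : a <= t <= b -> `|f t - (lcomb psi c0).[t]| <= E by rewrite c0E; exact: fE.
have := l1_recovery E0 Th1 m0 xab sL Ls re fE' Ss Ssum cmin.
set H := \sum_k _; set sg := s%:R `^ (1 - q^-1) * lp_norm q c0 => HH.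
rewrite -/(lcomb psi c).
have r1 : 1 <= Num.sqrt s%:R :> R by rewrite -[leLHS]sqrtr1 ler_wsqrtr// ler1n.
set r := Num.sqrt s%:R in HH r1 *.
have h1 : sup_norm a b (fun x => f x - (lcomb psi c).[x]) <= E + K * H.
  apply: sup_norm_le (ltW ab) _ => t tab.
  have -> : f t - (lcomb psi c).[t] = (f t - popt.[t]) - (lcomb psi (c - c0)).[t].
    by rewrite lcombD lcombN c0E hornerD hornerN; ring.
  apply: (le_trans (ler_normB _ _)); apply: lerD; first exact: fE.
  rewrite /lcomb horner_sum mulr_sumr; apply: (le_trans (ler_norm_sum _ _ _)).
  apply: ler_sum => k _; rewrite hornerZ normrM mulrC ler_wpM2r//.
  exact: psiK.
have K0 : 0 < K by exact: lt_le_trans K1.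
apply: (le_trans h1).
have h2 : K * H <= K * (4 * sg + 448 * r * Th%:R * E) by rewrite ler_pM2l.
have -> : K * 4 * A_norm psi q popt * s%:R `^ (1 - q^-1) = K * 4 * sg.
  by rewrite /sg /A_norm -/c0; ring.
have KrT : 1 <= K * r * Th%:R.
  by apply: mulr_ege1 => //; exact: mulr_ege1.
set B := (b - a) * M1 / N%:R.
have B0 : 0 <= B by rewrite divr_ge0// mulr_ge0// subr_ge0 ltW.
have -> : 6 * (b - a) * M1 * (K * 300 * Th%:R + 1) * (r / N%:R) =
    1800 * (B * (K * r * Th%:R)) + 6 * (B * r) by rewrite /B; ring.
apply: recovery_sum_le h2 => //; first by rewrite mulr_ge0// (le_trans ler01).
by apply: (le_trans EJ); rewrite /B !mulrA.
Qed.
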